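(* Let $G$ be either (i) a symmetric subgroup of $\mathrm{GL}_m(\mathbb{C})\times\mathrm{GL}_n(\mathbb{C})$ with $T_m(\mathbb{C})\times T_n(\mathbb{C})\le G$, acting on $\mathbb{C}^{m\times n}$ by $(X,Y)\cdot A=XAY^{-1}$, or (ii) a symmetric subgroup of $\mathrm{GL}_m(\mathbb{C})$ with $T_m(\mathbb{C})\le G$, acting by $X\cdot A=XA$ (in this case write $Y=I_n$ below). Let $A\in\mathbb{C}^{m\times n}$ be of full rank, define $\widetilde\kappa_F(X,Y)=\|XAY^{-1}\|_F\,\|YA^\dagger X^{-1}\|_F$ and $\kappa_F^\star=\inf_{(X,Y)\in G}\widetilde\kappa_F(X,Y)$, and let $C(K(X,Y))=\log\widetilde\kappa_F(X,Y)$. Consider the gradient descent iteration $(X_0,Y_0)=(I_m,I_n)$, $(X_{k+1},Y_{k+1})=(e^{-\eta H_k}X_k,e^{-\eta H_k'}Y_k)$ with $(H_k,H_k')=\nabla C(K(X_k,Y_k))$ and step size $\eta=1/8$. There is an absolute constant $c>0$ such that for every $0<\varepsilon<1/2$ and every integer $T\ge c\,\max(m^3,n^3)\,\log(\kappa_F(A)/\kappa_F^\star)/\varepsilon^2$, one has $\log\widetilde\kappa_F(X_T,Y_T)-\log\kappa_F^\star<\varepsilon$, where $\kappa_F(A)=\|A\|_F\|A^\dagger\|_F$.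
   Context: $T_m(\mathbb{C})$ denotes the group of invertible diagonal $m\times m$ matrices. A subgroup is symmetric if it is Zariski closed and closed under conjugate transposition (componentwise). $K=G\cap(\mathrm{U}_m\times\mathrm{U}_n)$ (resp. $G\cap\mathrm{U}_m$); $\mathrm{Lie}(G)=\{(H_1,H_2):(e^{tH_1},e^{tH_2})\in G\ \forall t\}$; $i\mathrm{Lie}(K)$ is the set of Hermitian pairs in $\mathrm{Lie}(G)$. The gradient $\nabla f(Kg)\in i\mathrm{Lie}(K)$ of smooth $f$ on $G/K$ is defined by $\langle\nabla f(Kg),H\rangle=\frac{d}{dt}|_{t=0}f(Ke^{tH}g)$ for all $H\in i\mathrm{Lie}(K)$, with $\langle(H_1,H_2),(H_3,H_4)\rangle=\mathrm{Re}(\mathrm{tr}(H_1^*H_3)+\mathrm{tr}(H_2^*H_4))$ and $e^{tH}(X,Y)=(e^{tH_1}X,e^{tH_2}Y)$. $^\dagger$ is the Moore–Penrose pseudoinverse. ($\widetilde\kappa_F(X,Y)=\kappa_F(XAY^{-1})$ when $A$ is invertible, or in case (ii) when $\mathrm{rank}A=m$.) *)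

(* Defs.v *)
From HB Require Import structures.
From mathcomp Require Import all_boot all_order all_algebra.
From mathcomp Require Import all_classical all_reals all_analysis.
From mathcomp Require Import complex.
Import numFieldNormedType.Exports.
Set Implicit Arguments. Unset Strict Implicit. Unset Printing Implicit Defensive.
Import Order.TTheory GRing.Theory Num.Theory.
Local Open Scope ring_scope.
Local Open Scope classical_set_scope.
Local Open Scope complex_scope.

Section Defs.
Variable R : realType.
Local Notation C := (complex R).

Definition adj m n (A : 'M[C]_(m, n)) : 'M[C]_(n, m) := (map_mx (@conjc R) A)^T.

Definition hermitian n (H : 'M[C]_n) : Prop := adj H = H.
Definition unitary n (U : 'M[C]_n) : Prop := adj U *m U = 1%:M.

Definition expm_partial n (H : 'M[C]_n) (N : nat) : 'M[C]_n :=
  \sum_(k < N) ((k`!)%:R^-1 : C) *: H ^+ k.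

Definition expm n (H : 'M[C]_n) : 'M[C]_n :=
  \matrix_(i, j) Complex (limn (fun N => complex.Re (expm_partial H N i j)))
                         (limn (fun N => complex.Im (expm_partial H N i j))).

Definition frob m n (A : 'M[C]_(m, n)) : R :=
  Num.sqrt (\sum_i \sum_j ((complex.Re (A i j)) ^+ 2 + (complex.Im (A i j)) ^+ 2)).

Definition is_pinv m n (A : 'M[C]_(m, n)) (B : 'M[C]_(n, m)) : Prop :=
  [/\ A *m B *m A = A, B *m A *m B = B,
      adj (A *m B) = A *m B & adj (B *m A) = B *m A].

Definition kappaF m n (A : 'M[C]_(m, n)) (Ad : 'M[C]_(n, m)) : R :=
  frob A * frob Ad.

Definition cinner n (H1 H2 : 'M[C]_n) : R := complex.Re (\tr (adj H1 *m H2)).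

Inductive polyfun (T : Type) (coord : set (T -> C)) : (T -> C) -> Prop :=
| pf_const (c : C) : polyfun coord (fun _ => c)
| pf_coord f : coord f -> polyfun coord f
| pf_add f g : polyfun coord f -> polyfun coord g -> polyfun coord (fun x => f x + g x)
| pf_mul f g : polyfun coord f -> polyfun coord g -> polyfun coord (fun x => f x * g x).

Definition pair_coords m n : set ('M[C]_m * 'M[C]_n -> C) :=
  [set f | (exists i j, f = fun g : 'M[C]_m * 'M[C]_n => g.1 i j) \/
          (exists i j, f = fun g : 'M[C]_m * 'M[C]_n => g.2 i j)].

Definition GL2 m n : set ('M[C]_m * 'M[C]_n) :=
  [set g | g.1 \in unitmx /\ g.2 \in unitmx].

Definition subgroup2 m n (G : set ('M[C]_m * 'M[C]_n)) : Prop :=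
  [/\ G `<=` (@GL2 m n), G (1%:M, 1%:M),
      (forall g h, G g -> G h -> G (g.1 *m h.1, g.2 *m h.2)) &
      (forall g, G g -> G (invmx g.1, invmx g.2))].

Definition zariski_closed2 m n (G : set ('M[C]_m * 'M[C]_n)) : Prop :=
  exists S : set ('M[C]_m * 'M[C]_n -> C),
    (forall p, S p -> polyfun (@pair_coords m n) p) /\
    (forall g, G g <-> (@GL2 m n g /\ forall p, S p -> p g = 0)).

Definition symmetric2 m n (G : set ('M[C]_m * 'M[C]_n)) : Prop :=
  [/\ subgroup2 G, zariski_closed2 G & forall g, G g -> G (adj g.1, adj g.2)].

Definition torus_in2 m n (G : set ('M[C]_m * 'M[C]_n)) : Prop :=
  forall X Y, is_diag_mx X -> X \in unitmx -> is_diag_mx Y -> Y \in unitmx -> G (X, Y).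

Definition Lie2 m n (G : set ('M[C]_m * 'M[C]_n)) : set ('M[C]_m * 'M[C]_n) :=
  [set H | forall t : R, G (expm (t%:C *: H.1), expm (t%:C *: H.2))].

Definition iLieK2 m n (G : set ('M[C]_m * 'M[C]_n)) : set ('M[C]_m * 'M[C]_n) :=
  [set H | Lie2 G H /\ hermitian H.1 /\ hermitian H.2].

Definition inner2 m n (H H' : 'M[C]_m * 'M[C]_n) : R :=
  cinner H.1 H'.1 + cinner H.2 H'.2.

Definition kappaT2 m n (A : 'M[C]_(m, n)) (Ad : 'M[C]_(n, m)) (g : 'M[C]_m * 'M[C]_n) : R :=
  frob (g.1 *m A *m invmx g.2) * frob (g.2 *m Ad *m invmx g.1).

(* Grad is the gradient of f at K g on G/K *)
Definition is_grad2 m n (G : set ('M[C]_m * 'M[C]_n)) (f : 'M[C]_m * 'M[C]_n -> R)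
    (g Grad : 'M[C]_m * 'M[C]_n) : Prop :=
  iLieK2 G Grad /\
  forall H, iLieK2 G H ->
    is_derive (0 : R) (1 : R)
      (fun t : R => f (expm (t%:C *: H.1) *m g.1, expm (t%:C *: H.2) *m g.2))
      (inner2 Grad H).

Definition coords1 m : set ('M[C]_m -> C) :=
  [set f | exists i j, f = fun X : 'M[C]_m => X i j].

Definition GL1 m : set 'M[C]_m := [set X | X \in unitmx].

Definition subgroup1 m (G : set 'M[C]_m) : Prop :=
  [/\ G `<=` (@GL1 m), G 1%:M,
      (forall X Y, G X -> G Y -> G (X *m Y)) &
      (forall X, G X -> G (invmx X))].

Definition zariski_closed1 m (G : set 'M[C]_m) : Prop :=
  exists S : set ('M[C]_m -> C),
    (forall p, S p -> polyfun (@coords1 m) p) /\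
    (forall X, G X <-> (@GL1 m X /\ forall p, S p -> p X = 0)).

Definition symmetric1 m (G : set 'M[C]_m) : Prop :=
  [/\ subgroup1 G, zariski_closed1 G & forall X, G X -> G (adj X)].

Definition torus_in1 m (G : set 'M[C]_m) : Prop :=
  forall X, is_diag_mx X -> X \in unitmx -> G X.

Definition Lie1 m (G : set 'M[C]_m) : set 'M[C]_m :=
  [set H | forall t : R, G (expm (t%:C *: H))].

Definition iLieK1 m (G : set 'M[C]_m) : set 'M[C]_m :=
  [set H | Lie1 G H /\ hermitian H].

Definition kappaT1 m n (A : 'M[C]_(m, n)) (Ad : 'M[C]_(n, m)) (X : 'M[C]_m) : R :=
  frob (X *m A) * frob (Ad *m invmx X).

Definition is_grad1 m (G : set 'M[C]_m) (f : 'M[C]_m -> R) (X Grad : 'M[C]_m) : Prop :=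
  iLieK1 G Grad /\
  forall H, iLieK1 G H ->
    is_derive (0 : R) (1 : R) (fun t : R => f (expm (t%:C *: H) *m X)) (cinner Grad H).

End Defs.

(* Main.v *)
Require Import Defs.
From HB Require Import structures.
From mathcomp Require Import all_boot all_order all_algebra.
From mathcomp Require Import all_classical all_reals all_analysis.
From mathcomp Require Import complex.
From mathcomp Require Import ring lra spectral.
Import numFieldNormedType.Exports.
Import Order.TTheory GRing.Theory Num.Theory.
Set Implicit Arguments. Unset Strict Implicit. Unset Printing Implicit Defensive.
Local Open Scope ring_scope.

(** Write [B = X A Y^-1] and [B' = Y A^+ X^-1]. Along a geodesic [t |-> exp (t H) g], in an eigenbasis of [H], both squared norms are sums of exponentials [p e^(2 t a)], where the exponents [a] are differences of an eigenvalue of [H_1] and one of [H_2]. Since [|a|] is bounded by the gradient norm along the gradient direction, [e^x <= 1 + x + 3/4 x^2] shows that a step of length 1/8 decreases [log kappa] by at least [|grad|^2 / 32].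

    Conversely, a small gradient forces near optimality. By polar decomposition any competitor is reached along some Hermitian [H]. The normalized entries [p] of [B] and [q] of [B'] form a flow on the bipartite graph whose vertices are the eigenvalues of [H_1] and [H_2], with divergence given by the gradient. Remove a maximal circulation: what remains is acyclic, so it admits an integral potential [l] in [0, m + n) increasing along its edges, and its mass is at most the derivative of the objective in the direction [l], hence at most [(m + n)^(3/2) |grad|]. The circulation has equal mass [s] on [p] and [q], and AM-GM on it bounds the ratio of the two values of [kappa] below by [s].

    The direction [l] must belong to [Lie G]. Because [G] is algebraic and contains the torus, [Lie G] is spanned by elementary matrices, so each of its two blocks is stable under functional calculus. This is shown algebraically: [Lie G] is replaced by the left-invariant derivations preserving the ideal of [G], and the passage between powers of a positive matrix, its logarithm, and its real powers is the linear independence of exponentials. *)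

(** * Circulations in finite graphs *)

(** Peel off sinks: a vertex of [S] without successor in [S] gets the top level [#|S| - 1], and the
    rest is treated recursively. When no sink remains, the remaining set is itself a trap. *)
Lemma level_or_trap (V : finType) (r : rel V) (S : {set V}) :
  (exists l : V -> nat, (forall v, v \in S -> l v < #|S|)%N /\
     forall u v, u \in S -> v \in S -> r u v -> (l u < l v)%N) \/
  (exists2 T : {set V}, T != finset.set0 &
     forall u, u \in T -> exists2 v, v \in T & r u v).
Proof.
have [k] := ubnP #|S|; elim: k S => // k IHk S leSk.
have [S0|S0] := eqVneq S finset.set0.
  by left; exists (fun=> 0%N); split=> [v|u v]; rewrite S0 inE.
case: (boolP [exists v in S, [forall u in S, ~~ r v u]]); last first.
  rewrite negb_exists_in => /forall_inP trap; right; exists S => // u uS.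
  move: (trap u uS); rewrite negb_forall_in => /existsP[v /andP[vS]].
  by rewrite negbK; exists v.
case/exists_inP => v vS /forall_inP vmax.
have cS : #|S| = #|S :\ v|.+1 by rewrite (cardsD1 v S) vS.
case: (IHk (S :\ v)); first by rewrite -ltnS -cS.
  case=> l [lS lr]; left; exists (fun u => if u == v then #|S :\ v| else l u).
  split=> [u uS|u w uS wS ruw].
    case: eqP => [_|/eqP uv]; first by rewrite cS.
    by rewrite cS ltnW // ltnS lS // !inE uv uS.
  have [uv|uv] := eqVneq u v; first by rewrite uv (negPf (vmax _ wS)) in ruw.
  have [wv|wv] := eqVneq w v; first by rewrite lS // !inE uv.
  by rewrite lr // !inE ?uv ?wv.
by move=> [T T0 HT]; right; exists T.
Qed.

(* A functional subgraph restricted to a minimal forward-invariant set is a permutation, hence a circulation. *)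
Lemma permuted_subset (V : finType) (g : V -> V) (S : {set V}) :
  S != finset.set0 -> (forall u, u \in S -> g u \in S) ->
  exists T : {set V}, [/\ T != finset.set0, T \subset S, g @: T = T & {in T &, injective g}].
Proof.
move=> S0 gS.
pose P (T : {set V}) := [&& T != finset.set0, T \subset S & g @: T \subset T].
have PS : P S.
  by rewrite /P S0 subxx; apply/fintype.subsetP => _ /imsetP[u uS ->]; apply: gS.
have [T /minsetP[/and3P[T0 TS gT] Tmin] _] := minset_exists PS.
have gTT : g @: T = T.
  apply: Tmin => //; apply/and3P; split; last exact: finset.imsetS.
    by case/finset.set0Pn: T0 => x xT; apply/finset.set0Pn; exists (g x); apply: imset_f.
  exact: fintype.subset_trans gT TS.
by exists T; split=> //; apply/imset_injP; rewrite gTT.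
Qed.

(** Cycle cancelling, by induction on the number of edges of positive weight. If these edges admit a
    level function, the zero circulation works; otherwise a trap contains a permutation along such
    edges, and subtracting the circulation it carries kills an edge. *)
Lemma flow_decomposition (R : realFieldType) (V E : finType) (src tgt : E -> V)
    (a : E -> R) : (forall e, 0 <= a e) ->
  exists (c : E -> R) (l : V -> nat),
    [/\ forall e, 0 <= c e <= a e,
        forall v, \sum_(e | tgt e == v) c e = \sum_(e | src e == v) c e,
        forall v, (l v < #|V|)%N &
        forall e, c e < a e -> (l (src e) < l (tgt e))%N].
Proof.
have [k] := ubnP #|[set e | 0 < a e]|; elim: k a => // k IHk a leak a0.
pose r u v := [exists e, [&& 0 < a e, src e == u & tgt e == v]].
case: (level_or_trap r [set: V]) => [[l [lV lr]]|[S S0 trap]].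
  exists (fun=> 0), l; split=> // [e|v|v|e ae]; first by rewrite lexx a0.
  - by rewrite !big1.
  - by have := lV v; rewrite inE cardsT => ->.
  - by apply: lr; rewrite ?inE //; apply/existsP; exists e; rewrite ae !eqxx.
have [u0 u0S] := finset.set0Pn _ S0.
have /fin_all_exists[f fP] : forall u, exists e, u \in S ->
    [&& 0 < a e, src e == u & tgt e \in S].
  move=> u; case: (boolP (u \in S)) => [uS|_]; last first.
    (* Outside the trap the choice is immaterial; the nonempty trap supplies a default edge. *)
    by have [v vS /existsP[e _]] := trap _ u0S; exists e.
  have [v vS /existsP[e /and3P[ae se /eqP te]]] := trap _ uS.
  by exists e; rewrite ae se te.
have [T [T0 TS gT ginj]] : exists T : {set V}, [/\ T != finset.set0, T \subset S,
    (tgt \o f) @: T = T & {in T &, injective (tgt \o f)}].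
  by apply: permuted_subset S0 _ => u /fP /and3P[].
have fT u : u \in T -> 0 < a (f u) /\ src (f u) = u.
  by move=> /(fintype.subsetP TS) /fP /and3P[-> /eqP].
have finj : {in T &, injective f}.
  by move=> u v uT vT fuv; rewrite -(fT _ uT).2 fuv (fT _ vT).2.
have [v0 v0T] := finset.set0Pn _ T0.
(* The largest constant that can be removed along the permutation; the edge [f w] loses its whole
   weight. *)
pose w := [arg min_(u < v0 in T) a (f u)]%O.
have [wT wmin] : w \in T /\ forall u, u \in T -> a (f w) <= a (f u).
  by rewrite /w; case: arg_minP.
pose c0 e := if e \in f @: T then a (f w) else 0.
have c0a e : 0 <= c0 e <= a e.
  rewrite /c0; case: ifP => [/imsetP[u uT ->]|_]; last by rewrite lexx a0.
  by rewrite a0 wmin.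
have sum_c0 (h : E -> V) v : \sum_(e | h e == v) c0 e =
    \sum_(u in T | h (f u) == v) a (f w).
  rewrite [LHS]big_mkcond [RHS]big_mkcondr /= -(big_imset (fun e =>
    if h e == v then a (f w) else 0)) //= [RHS]big_mkcond /=.
  by apply: eq_bigr => e _; rewrite /c0; do 2!case: ifP.
have c0circ v : \sum_(e | tgt e == v) c0 e = \sum_(e | src e == v) c0 e.
  rewrite !sum_c0 [LHS]big_mkcondr [RHS]big_mkcondr /=.
  transitivity (\sum_(u in T) if u == v then a (f w) else 0); last first.
    by apply: eq_bigr => u uT; rewrite (fT _ uT).2.
  rewrite -[in RHS]gT big_imset //=.
have [|e|c [l [c_a ccirc lV lr]]] := IHk (fun e => a e - c0 e).
- rewrite -ltnS; apply: leq_trans leak; rewrite ltnS; apply: fintype.proper_card.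
  apply/fintype.properP; split.
    apply/fintype.subsetP => e; rewrite !inE => /lt_le_trans; apply.
    by rewrite gerBl; case/andP: (c0a e).
  exists (f w); first by rewrite inE; case: (fT _ wT).
  by rewrite inE /c0 imset_f // subrr ltxx.
- by rewrite subr_ge0; case/andP: (c0a e).
- exists (fun e => c e + c0 e), l; split=> // [e|v|e].
  + have /andP[h1 h2] := c_a e; have /andP[h3 h4] := c0a e.
    by rewrite addr_ge0 //= -lerBrDr.
  + by rewrite !big_split /= ccirc c0circ.
  + by rewrite -ltrBrDr; apply: lr.
Qed.

(** * Estimates for sums of exponentials *)

(** Each exponential lies above its tangent line at the weighted mean [y], and the linear parts
    cancel on summation. *)
Lemma weighted_AMGM (R : realType) (I : finType) (P : pred I) (c x : I -> R) (s : R) :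
  (forall i, 0 <= c i) -> \sum_(i | P i) c i = s -> 0 < s ->
  s * expR ((\sum_(i | P i) c i * x i) / s) <= \sum_(i | P i) c i * expR (x i).
Proof.
move=> c0 cs s0; set y := _ / s.
have tangent i : P i -> c i * (expR y * (1 + (x i - y))) <= c i * expR (x i).
  move=> _; apply: ler_wpM2l => //.
  have -> : expR (x i) = expR y * expR (x i - y) by rewrite -expRD addrC subrK.
  by rewrite ler_wpM2l ?expR_ge0 ?expR_ge1Dx.
apply: le_trans (ler_sum _ tangent).
under eq_bigr do rewrite mulrCA.
rewrite -mulr_sumr.
have -> : \sum_(i | P i) c i * (1 + (x i - y)) = s.
  under eq_bigr do rewrite mulrDr mulr1 mulrBr.
  by rewrite big_split /= sumrB -mulr_suml cs /y mulrC mulfVK ?gt_eqF // subrr addr0.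
by rewrite mulrC.
Qed.

(* The residual flow left after removing a maximal circulation strictly increases the level [l], so its mass is at most the first-order change of the flow in the direction [l]. *)
Lemma bipartite_capacity_bound (R : realType) (V E : finType) (src tgt : E -> V)
    (side : pred V) (a : E -> R) :
  (forall e, 0 <= a e) -> (forall e, side (src e) = ~~ side (tgt e)) ->
  \sum_(e | side (tgt e)) a e = 1 -> \sum_(e | ~~ side (tgt e)) a e = 1 ->
  exists l : V -> nat, (forall v, (l v < #|V|)%N) /\
    let s := 1 - 2^-1 * \sum_e a e * ((l (tgt e))%:R - (l (src e))%:R) in
    0 <= s -> forall x : V -> R,
    s ^+ 2 <= (\sum_(e | side (tgt e)) a e * expR (x (tgt e) - x (src e))) *
              (\sum_(e | ~~ side (tgt e)) a e * expR (x (tgt e) - x (src e))).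
Proof.
move=> a0 bip a1 a2.
have [c [l [ca circ lV lr]]] := flow_decomposition src tgt a0.
have c0 e : 0 <= c e by case/andP: (ca e).
have cle e : c e <= a e by case/andP: (ca e).
have circh (h : V -> R) : \sum_e c e * h (tgt e) = \sum_e c e * h (src e).
  rewrite (partition_big tgt xpredT) // [RHS](partition_big src xpredT) //=.
  apply: eq_bigr => v _.
  under eq_bigr => e /eqP -> do over.
  under [RHS]eq_bigr => e /eqP -> do over.
  by rewrite -!mulr_suml circ.
exists l; split=> // s sge0 x.
pose s0 := \sum_(e | side (tgt e)) c e.
have s0q : \sum_(e | ~~ side (tgt e)) c e = s0.
  (* Every edge crosses the bipartition, so testing the circulation against the indicator of [side]
     compares its masses on the two classes of edges. *)
  have := circh (fun v => (side v)%:R).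
  under eq_bigr do rewrite mulr_natr mulrb; rewrite -big_mkcond /= -/s0 => ->.
  under [RHS]eq_bigr do rewrite mulr_natr mulrb bip; by rewrite -big_mkcond.
(* The total mass is 2, of which the circulation takes [2 * s0]. Each residual edge rises by at
   least one level, while the circulation contributes nothing to the total rise. *)
have ss0 : s <= s0.
  have : \sum_e (a e - c e) <=
      \sum_e (a e - c e) * ((l (tgt e))%:R - (l (src e))%:R).
    apply: ler_sum => e _; have [ce|ae] := ltP (c e) (a e).
      rewrite ler_peMr ?subr_ge0 // lerBrDl natr1 ler_nat.
      exact: lr.
    have -> : a e = c e by apply/le_anti; rewrite ae cle.
    by rewrite subrr mul0r.
  rewrite sumrB (bigID (fun e => side (tgt e))) /= a1 a2.
  rewrite [X in _ - X](bigID (fun e => side (tgt e))) /= s0q -/s0.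
  under [X in _ <= X]eq_bigr do rewrite mulrBl [c _ * _]mulrBr.
  rewrite sumrB [X in _ <= _ - X]sumrB (circh (fun v => (l v)%:R)) subrr subr0.
  rewrite /s; lra.
have cP (P : pred E) (y : E -> R) : \sum_(e | P e) c e * expR (y e) <=
    \sum_(e | P e) a e * expR (y e).
  by apply: ler_sum => e _; rewrite ler_wpM2r ?expR_ge0.
have [s00|s0pos] := eqVneq s0 0.
  have -> : s = 0 by apply/le_anti; rewrite sge0 -s00 ss0.
  rewrite expr0n mulr_ge0 //; apply: sumr_ge0 => e _; by rewrite mulr_ge0 ?expR_ge0.
have {}s0pos : 0 < s0 by rewrite lt_neqAle eq_sym s0pos (le_trans sge0).
pose y e := x (tgt e) - x (src e).
have Ap := le_trans (weighted_AMGM y c0 (erefl s0) s0pos) (cP _ y).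
have Aq := le_trans (weighted_AMGM y c0 s0q s0pos) (cP _ y).
apply: le_trans (ler_pM _ _ Ap Aq); rewrite ?mulr_ge0 ?expR_ge0 ?(ltW s0pos) //.
rewrite mulrACA -expRD -mulrDl.
(* Differences of [x] sum to zero along a circulation, so the two exponents cancel in the
   product. *)
have -> : \sum_(e | side (tgt e)) c e * y e + \sum_(e | ~~ side (tgt e)) c e * y e = 0.
  rewrite -(bigID (fun e => side (tgt e)) predT) /=.
  under eq_bigr do rewrite mulrBr.
  by rewrite sumrB (circh x) subrr.
by rewrite mul0r expR0 mulr1 expr2 ler_pM.
Qed.

(** Since [(k + 2)! >= 2 * 3^k], the tail is dominated by a geometric series of ratio 1/3, with sum
    [1/2 * 3/2 = 3/4]. *)
Lemma expR_le_quadratic (R : realType) (x : R) : `|x| <= 1 ->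
  expR x <= 1 + x + 3 / 4 * x ^+ 2.
Proof.
move=> x1.
have term k : x ^+ k.+2 / (k.+2)`!%:R <= x ^+ 2 * (2^-1 * (3^-1) ^+ k).
  have fk : (2 * 3 ^ k <= (k.+2)`!)%N.
    elim: k => // k IH; rewrite factS expnS mulnCA.
    exact: leq_trans (leq_mul (leqnn 3) IH) (leq_mul _ (leqnn _)).
  apply: le_trans (ler_norm _) _.
  rewrite normrM normfV normr_nat normrX.
  have -> : `|x| ^+ k.+2 = x ^+ 2 * `|x| ^+ k.
    by rewrite -addn2 exprD real_normK ?num_real // mulrC.
  rewrite -mulrA; apply: ler_wpM2l; first exact: sqr_ge0.
  apply: (@le_trans _ _ (1 / (k.+2)`!%:R)).
    by rewrite ler_wpM2r ?invr_ge0 ?ler0n ?exprn_ile1.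
  rewrite mul1r exprVn -invfM lef_pV2 ?posrE ?ltr0n ?fact_gt0 ?mulr_gt0 ?exprn_gt0 //.
  by rewrite -natrX -natrM ler_nat.
have partial n : series (exp_coeff x) n.+2 <=
    1 + x + x ^+ 2 * (3 / 4 * (1 - (3^-1) ^+ n)).
  elim: n => [|n IH].
    rewrite /series /= !big_nat_recr //= big_geq // /exp_coeff /=.
    by rewrite fact0 expr0 expr1 subrr !mulr0 add0r addr0 !divr1.
  rewrite /series /= big_nat_recr //=.
  apply: le_trans (lerD IH (term n)) _.
  have -> : (3^-1 : R) ^+ n.+1 = 3^-1 * 3^-1 ^+ n by rewrite exprS.
  lra.
rewrite /expR; apply: limr_le; first exact: is_cvg_series_exp_coeff.
exists 2%N => // n /= n2; rewrite -(subnK n2) addn2.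
apply: le_trans (partial _) _; rewrite lerD2l mulrC ler_wpM2r ?sqr_ge0 //.
rewrite ler_piMr // ?gerBl ?exprn_ge0 //; lra.
Qed.

(** The exponent [- a / 4] comes from a step 1/8 along an exponent [2 a]. The bound on [nu] gives
    [|a / 4| <= 1], the quadratic term costs at most [3/4 * 2 nu / 16], and [ln (1 + u) <= u]
    concludes. *)
Lemma ln_mean_exp_le (R : realType) (I : finType) (P : pred I) (p a : I -> R) (nu : R) :
  (forall i, 0 <= p i) -> \sum_(i | P i) p i = 1 ->
  (forall i, a i ^+ 2 <= 2 * nu) -> nu <= 8 ->
  ln (\sum_(i | P i) p i * expR (- (a i / 4))) <=
    - ((\sum_(i | P i) p i * a i) / 4) + 3 / 32 * nu.
Proof.
move=> p0 p1 anu nu8.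
have ub : \sum_(i | P i) p i * expR (- (a i / 4)) <=
    1 + (- ((\sum_(i | P i) p i * a i) / 4) + 3 / 32 * nu).
  apply: (@le_trans _ _ (\sum_(i | P i) p i * (1 + (- (a i / 4) + 3 / 32 * nu)))); last first.
    under eq_bigr do rewrite mulrDr mulr1 mulrDr mulrN mulrA.
    by rewrite big_split /= p1 big_split /= sumrN -!mulr_suml p1 mul1r.
  apply: ler_sum => i _.
  apply: ler_wpM2l => //; have h := anu i.
  have a4 : `|a i / 4| <= 1.
    rewrite normrM normfV normr_nat ler_pdivrMr // mul1r -ler_sqr ?nnegrE //.
    rewrite real_normK ?num_real //; nra.
  apply: le_trans (expR_le_quadratic _) _; first by rewrite normrN.
  rewrite sqrrN expr_div_n; lra.
have pos : 0 < \sum_(i | P i) p i * expR (- (a i / 4)).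
  rewrite lt_neqAle sumr_ge0 ?andbT; last by move=> i _; rewrite mulr_ge0 ?expR_ge0.
  rewrite eq_sym psumr_neq0; last by move=> i _; rewrite mulr_ge0 ?expR_ge0.
  have : \sum_(i | P i) p i != 0 by rewrite p1 oner_eq0.
  rewrite psumr_neq0 // => /hasP[i iI /andP[Pi pi]].
  by apply/hasP; exists i => //; rewrite Pi mulr_gt0 ?expR_gt0.
apply: le_trans (le_ln1Dx _); last by have := lt_le_trans pos ub; lra.
by rewrite ler_ln ?posrE //; apply: lt_le_trans pos ub.
Qed.

(** * Tangent derivations of an algebraic group *)

Lemma polynomial_interpolation (F : fieldType) (f : F -> F) (zs : seq F) :
  exists q : {poly F}, forall x, x \in zs -> q.[x] = f x.
Proof.
elim: zs => [|y zs [q qP]]; first by exists 0.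
  have [yzs|yzs] := boolP (y \in zs).
    by exists q => x; rewrite inE => /predU1P[->|]; apply: qP.
  pose p := \prod_(u <- zs) ('X - u%:P).
  have py : p.[y] != 0 by rewrite -[_ == 0]/(root p y) root_prod_XsubC.
  exists (q + ((f y - q.[y]) / p.[y]) *: p) => x; rewrite inE hornerD hornerZ.
  have [->|_ /= xzs] := eqVneq x y; first by rewrite divfK // addrC subrK.
  have /rootP-> : root p x by rewrite root_prod_XsubC.
  by rewrite mulr0 addr0 qP.
Qed.

(** A Vandermonde argument allowing repeated nodes: [f] agrees with a polynomial on the finitely
    many [z r], so the sum is a combination of power sums. *)
Lemma power_sums_eq0 (F : fieldType) (I : eqType) (s : seq I) (c z : I -> F)
    (f : F -> F) :
  (forall k, \sum_(r <- s) c r * z r ^+ k = 0) -> \sum_(r <- s) c r * f (z r) = 0.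
Proof.
move=> pow0.
have [q qP] := polynomial_interpolation f [seq z r | r <- s].
transitivity (\sum_(r <- s) \sum_(i < size q) q`_i * (c r * z r ^+ i)).
  apply: eq_big_seq => r rs; rewrite -qP ?map_f // horner_coef mulr_sumr.
  by apply: eq_bigr => i _; rewrite mulrCA.
by rewrite exchange_big big1 //= => i _; rewrite -mulr_sumr pow0 mulr0.
Qed.

Section PolynomialExpressions.
Variables (F : comNzRingType) (N : nat).

(** Polynomials in the matrix entries are kept as syntax, so that derivations are defined by
    recursion and can be iterated. *)
Inductive pexpr :=
| PConst of F
| PCoord of 'I_N & 'I_N
| PAdd of pexpr & pexpr
| PMul of pexpr & pexpr.

Fixpoint peval (e : pexpr) (M : 'M[F]_N) : F :=
  match e with
  | PConst c => c
  | PCoord i j => M i j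
  | PAdd e1 e2 => peval e1 M + peval e2 M
  | PMul e1 e2 => peval e1 M * peval e2 M
  end.

(* The left-invariant derivation [p |-> (M |-> d/dt p (M (1 + t Z)))]. *)
Fixpoint pder (Z : 'M[F]_N) (e : pexpr) : pexpr :=
  match e with
  | PConst _ => PConst 0
  | PCoord i j =>
      foldr (fun k => PAdd (PMul (PCoord i k) (PConst (Z k j)))) (PConst 0) (enum 'I_N)
  | PAdd e1 e2 => PAdd (pder Z e1) (pder Z e2)
  | PMul e1 e2 => PAdd (PMul (pder Z e1) e2) (PMul e1 (pder Z e2))
  end.

Lemma peval_pder_coord Z i j M : peval (pder Z (PCoord i j)) M = (M *m Z) i j.
Proof.
rewrite mxE -big_enum /=; elim: (enum _) => [|k s IH] /=; first by rewrite big_nil.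
by rewrite big_cons IH.
Qed.

Lemma peval_pderD a Z W e M :
  peval (pder (a *: Z + W) e) M = a * peval (pder Z e) M + peval (pder W e) M.
Proof.
elim: e => [c|i j|e1 IH1 e2 IH2|e1 IH1 e2 IH2].
- by rewrite /= mulr0 addr0.
- by rewrite !peval_pder_coord mulmxDr -scalemxAr !mxE.
- by rewrite /= IH1 IH2; ring.
- by rewrite /= IH1 IH2; ring.
Qed.

Lemma peval_pder2_coord Z W i j M :
  peval (pder Z (pder W (PCoord i j))) M = (M *m Z *m W) i j.
Proof.
rewrite mxE -big_enum [pder W _]/=.
elim: (enum _) => [|k s IH]; first by rewrite big_nil.
by rewrite big_cons -IH -peval_pder_coord /= mulr0 addr0.
Qed.

(** A commutator of derivations is a derivation, so coordinates decide; there it reads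
    [M Z W - M W Z]. *)
Lemma peval_pder_bracket Z W e M :
  peval (pder (Z *m W - W *m Z) e) M =
  peval (pder Z (pder W e)) M - peval (pder W (pder Z e)) M.
Proof.
elim: e => [c|i j|e1 IH1 e2 IH2|e1 IH1 e2 IH2].
- by rewrite /= subrr.
- by rewrite peval_pder_coord !peval_pder2_coord mulmxBr !mulmxA !mxE.
- by rewrite /= IH1 IH2; ring.
- by rewrite /= IH1 IH2; ring.
Qed.

Variable G : 'M[F]_N -> Prop.

Definition vanishing (e : pexpr) := forall g, G g -> peval e g = 0.

(** For an algebraic group this is its Lie algebra. Preserving the whole ideal, at every point of
    [G], makes brackets and iterated derivatives immediate. *)
Definition tangent (Z : 'M[F]_N) := forall e, vanishing e -> vanishing (pder Z e).

Lemma tangent_lin a Z W : tangent Z -> tangent W -> tangent (a *: Z + W).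
Proof.
by move=> tZ tW e ve g Gg; rewrite peval_pderD tZ // tW // mulr0 addr0.
Qed.

Lemma tangent0 : tangent 0.
Proof.
move=> e _ g _; have := peval_pderD (- 1) 0 0 e g.
by rewrite scaler0 addr0 mulN1r addNr.
Qed.

Lemma tangentZ a Z : tangent Z -> tangent (a *: Z).
Proof. by move=> tZ; rewrite -[_ *: _]addr0; apply: tangent_lin => //; apply: tangent0. Qed.

Lemma tangentD Z W : tangent Z -> tangent W -> tangent (Z + W).
Proof. by move=> tZ tW; rewrite -[Z]scale1r; apply: tangent_lin. Qed.

Lemma tangent_bracket Z W : tangent Z -> tangent W -> tangent (Z *m W - W *m Z).
Proof.
move=> tZ tW e ve g Gg; rewrite peval_pder_bracket.
by rewrite (tZ _ (tW _ ve) _ Gg) (tW _ (tZ _ ve) _ Gg) subrr.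
Qed.

End PolynomialExpressions.

(** * Root spaces of the torus and functional calculus *)

Section RootSpaces.
Variables (F : numFieldType) (N : nat) (G : 'M[F]_N -> Prop) (act : pred 'I_N).
Hypothesis tangent_torus : forall k, act k -> tangent G (delta_mx k k).
Local Notation tangent := (tangent G).

Lemma bracket_delta_diag k (Z : 'M[F]_N) i j :
  (delta_mx k k *m Z - Z *m delta_mx k k) i j = ((i == k)%:R - (j == k)%:R) * Z i j.
Proof.
rewrite !mxE (bigD1 k) //= [X in _ - X](bigD1 k) //= !big1 ?addr0.
- rewrite !mxE eqxx andbT /= mulrBl [_%:R * Z i j]mulrC; congr (_ - _).
    by case: eqP => [->|_]; rewrite ?(mul0r, mulr0, mul1r, mulr1).
  by rewrite mulrC; case: eqP => [->|_]; rewrite ?(mul0r, mulr0, mul1r, mulr1).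
- by move=> l /negPf lk; rewrite mxE lk mulr0.
- by move=> l /negPf lk; rewrite mxE lk andbF mul0r.
Qed.

(* [(x^2 + x)/2] applied to the adjoint action of [E_ii], and [(x^2 - x)/2] applied to that of [E_jj], isolate the [(i, j)] entry. *)
Lemma tangent_root Z i j : act i -> act j -> i != j -> tangent Z ->
  Z i j != 0 -> tangent (delta_mx i j).
Proof.
move=> ai aj ij tZ Zij.
have [B [tB BE]] : exists B : 'I_N -> 'M[F]_N -> 'M[F]_N,
    (forall k Y, act k -> tangent Y -> tangent (B k Y)) /\
    (forall k Y a b, B k Y a b = ((a == k)%:R - (b == k)%:R) * Y a b).
  exists (fun k Y => delta_mx k k *m Y - Y *m delta_mx k k); split=> [k Y ak tY|k Y a b].
    by apply: tangent_bracket => //; apply: tangent_torus.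
  exact: bracket_delta_diag.
pose P := 2^-1 *: (B i (B i Z) + B i Z).
pose Q := 2^-1 *: (B j (B j P) + (- 1) *: B j P).
have tP : tangent P.
  apply/tangentZ/tangentD; last exact: tB.
  by apply: (tB) => //; apply: tB.
have tQ : tangent Q.
  apply/tangentZ/tangentD; last by apply: tangentZ; apply: tB.
  by apply: (tB) => //; apply: tB.
have -> : delta_mx i j = (Z i j)^-1 *: Q; last exact: tangentZ.
apply/matrixP => a b.
have PE : P a b = ((a == i) && (b != i))%:R * Z a b.
  by rewrite /P mxE mxE !BE; do 2!case: eqP => _ /=; field.
have QE : Q a b = ((b == j) && (a != j))%:R * P a b.
  by rewrite /Q mxE mxE mxE !BE; do 2!case: eqP => _ /=; field.
rewrite [LHS]mxE [RHS]mxE QE PE.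
have [->|/=] := eqVneq a i; last by rewrite !(mul0r, mulr0).
have [->|/=] := eqVneq b j; last by rewrite !(mul0r, mulr0).
by rewrite ij eq_sym ij !mul1r mulVf.
Qed.

(** Diagonal entries are unrestricted: scalar matrices must qualify for the condition to pass to
    polynomials in a matrix. The diagonal is controlled separately in [root_supported_tangent]. *)
Definition root_supported (Z : 'M[F]_N) :=
  forall i j, i != j -> Z i j != 0 -> tangent (delta_mx i j).

Lemma root_supported_tangent Z : root_supported Z ->
  (forall i, ~~ act i -> Z i i = 0) -> tangent Z.
Proof.
move=> sZ dZ; rewrite (matrix_sum_delta Z).
elim/big_ind: _ => [|Y W tY tW|i _]; [exact: tangent0|exact: tangentD|].
elim/big_ind: _ => [|Y W tY tW|j _]; [exact: tangent0|exact: tangentD|].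
have [->|Zij] := eqVneq (Z i j) 0; first by rewrite scale0r; apply: tangent0.
apply: tangentZ; have [ij|ij] := eqVneq i j; last exact: sZ.
rewrite -ij; apply: tangent_torus; apply/negPn/negP => /dZ Zii.
by rewrite -ij Zii eqxx in Zij.
Qed.

(** A nonzero entry of the product has a nonzero term through some [k]. If [k] differs from both
    ends, [E_ij] is the bracket of [E_ik] and [E_kj]. *)
Lemma root_supportedM Z W : root_supported Z -> root_supported W ->
  root_supported (Z *m W).
Proof.
move=> sZ sW i j ij; rewrite mxE => sum0.
have [k] : exists k, Z i k * W k j != 0.
  apply: contrapT => /forallNP no; case/eqP: sum0; apply: big1 => k _.
  by apply/eqP/negPn/negP => /no.
rewrite mulf_eq0 negb_or => /andP[Zik Wkj].
have [ik|ik] := eqVneq i k; first by apply: sW => //; rewrite ik.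
have [kj|kj] := eqVneq k j; first by apply: sZ => //; rewrite -kj.
have -> : delta_mx i j = delta_mx i k *m delta_mx k j - delta_mx k j *m delta_mx i k :> 'M[F]_N.
  by rewrite !mul_delta_mx_cond eqxx eq_sym (negPf ij) mulr1n mulr0n subr0.
by apply: tangent_bracket; [apply: sZ|apply: sW].
Qed.

Lemma root_supportedD Z W : root_supported Z -> root_supported W ->
  root_supported (Z + W).
Proof.
move=> sZ sW i j ij; rewrite mxE.
have [->|Zij _] := eqVneq (Z i j) 0; first by rewrite add0r; apply: sW.
exact: sZ.
Qed.

Lemma root_supported_diag d : root_supported (diag_mx d).
Proof. by move=> i j ij; rewrite mxE (negPf ij) mulr0n eqxx. Qed.

Lemma root_supported_functional_calculus (U V : 'M[F]_N) (h : 'I_N -> F) (f : F -> F) :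
  U *m V = 1%:M -> V *m U = 1%:M ->
  root_supported (U *m diag_mx (\row_i h i) *m V) ->
  root_supported (U *m diag_mx (\row_i f (h i)) *m V).
Proof.
move=> UV VU sH.
have poly q : root_supported (U *m diag_mx (\row_i (q.[h i])) *m V).
  elim/poly_ind: q => [|q c IH].
    have -> : (\row_i (0 : {poly F}).[h i]) = 0 by apply/rowP => i; rewrite !mxE horner0.
    by rewrite raddf0 mulmx0 mul0mx => i j _; rewrite mxE eqxx.
  have -> : diag_mx (\row_i (q * 'X + c%:P).[h i]) =
      diag_mx (\row_i q.[h i]) *m (V *m U) *m diag_mx (\row_i h i) + c%:M.
    rewrite VU mulmx1 mulmx_diag -diag_const_mx -raddfD; congr diag_mx.
    by apply/rowP => i; rewrite !mxE hornerMXaddC.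
  rewrite mulmxDr mulmxDl mul_mx_scalar -scalemxAl UV.
  apply: root_supportedD; last by rewrite scalemx1 -diag_const_mx; apply: root_supported_diag.
  by move: (root_supportedM IH sH); rewrite !mulmxA.
have [q qP] : exists q : {poly F}, forall i, q.[h i] = f (h i).
  have [q qP] := polynomial_interpolation f (codom h).
  by exists q => i; apply/qP/codom_f.
have := poly q; congr (root_supported (_ *m diag_mx _ *m _)).
by apply/rowP => i; rewrite !mxE qP.
Qed.
End RootSpaces.

(** Taken with [V] inverse to [U], this is a matrix with its eigenbasis kept explicit; products,
    powers and exponentials act entrywise on [x]. *)
Definition dconj (F : comNzRingType) (N : nat) (U V : 'M[F]_N) (x : 'I_N -> F) : 'M[F]_N :=
  U *m diag_mx (\row_i x i) *m V.

Lemma dconjM (F : comNzRingType) N (U V : 'M[F]_N) x y : V *m U = 1%:M ->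
  dconj U V x *m dconj U V y = dconj U V (fun i => x i * y i).
Proof.
move=> VU; rewrite /dconj !mulmxA -(mulmxA _ V U) VU mulmx1 -(mulmxA U) mulmx_diag.
by congr (_ *m diag_mx _ *m _); apply/rowP => i; rewrite !mxE.
Qed.

Lemma dconj1 (F : comNzRingType) N (U V : 'M[F]_N) : U *m V = 1%:M ->
  dconj U V (fun=> 1) = 1%:M.
Proof.
move=> UV; rewrite /dconj; have -> : (\row_(i < N) (1 : F)) = const_mx 1.
  by apply/rowP => i; rewrite !mxE.
by rewrite diag_const_mx mulmx1.
Qed.

Lemma dconjE (F : comNzRingType) N (U V : 'M[F]_N) x i j :
  dconj U V x i j = \sum_k U i k * x k * V k j.
Proof. by rewrite mxE; apply: eq_bigr => k _; rewrite mul_mx_diag !mxE. Qed.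

Lemma dconj_unit (F : fieldType) N (U V : 'M[F]_N) x :
  U *m V = 1%:M -> V *m U = 1%:M -> (forall i, x i != 0) -> dconj U V x \in unitmx.
Proof.
move=> UV VU x0; suff /mulmx1_unit[] : dconj U V x *m dconj U V (fun i => (x i)^-1) = 1%:M.
  by [].
rewrite dconjM // -(dconj1 UV); congr dconj; apply/funext => i; exact: mulfV.
Qed.

(** * One-parameter groups and exponential sums *)

Section OneParameterGroups.
Local Open Scope complex_scope.
Variables (R : realType) (N : nat).
Local Notation C := (complex R).
Variables (U V : 'M[C]_N) (w : 'I_N -> R).
Hypotheses (UV : U *m V = 1%:M) (VU : V *m U = 1%:M).

Let W := dconj U V (fun i => (w i)%:C).
Let expW (t : R) := dconj U V (fun i => (expR (t * w i))%:C).

Let expWM t : expW t *m W = dconj U V (fun i => (expR (t * w i))%:C * (w i)%:C).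
Proof. exact: dconjM. Qed.

(** Coefficients and frequencies do not depend on [t], and one list serves both the function and its
    derivative. Frequencies may repeat, which keeps products simple. *)
Lemma peval_exponential_sum (e : pexpr C N) (g : 'M[C]_N) :
  exists s : seq (C * R), forall t,
    peval e (g *m expW t) = \sum_(r <- s) r.1 * (expR (t * r.2))%:C /\
    peval (pder W e) (g *m expW t) = \sum_(r <- s) r.1 * (r.2)%:C * (expR (t * r.2))%:C.
Proof.
elim: e => [c|i j|e1 [s1 IH1] e2 [s2 IH2]|e1 [s1 IH1] e2 [s2 IH2]].
- exists [:: (c, 0)] => t; rewrite !big_seq1 /= !mulr0 expR0 mulr1; split=> //.
  by rewrite mul0r.
- exists [seq ((g *m U) i k * V k j, w k) | k <- enum 'I_N] => t.
  rewrite peval_pder_coord -mulmxA expWM [in X in X /\ _]big_map [in X in _ /\ X]big_map !big_enum /= /expW /dconj !mulmxA.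
  split; rewrite mxE; apply: eq_bigr => k _; rewrite mul_mx_diag !mxE; ring.
- exists (s1 ++ s2) => t; rewrite !big_cat /=.
  by have [-> ->] := IH1 t; have [-> ->] := IH2 t.
- exists [seq (r.1 * r'.1, r.2 + r'.2) | r <- s1, r' <- s2] => t.
  rewrite !big_allpairs_dep /=; have [-> ->] := IH1 t; have [-> ->] := IH2 t.
  split; first rewrite mulr_suml; last rewrite !mulr_suml -big_split /=;
    apply: eq_bigr => r _; rewrite !mulr_sumr -?big_split; apply: eq_bigr => r' _;
    rewrite /= mulrDr expRD ?rmorphD ?rmorphM /=; ring.
Qed.

(** Natural times suffice: they give all power sums of the nodes [expR r.2], and the logarithm
    recovers a frequency from its node. *)
Lemma exponential_sum_apply (s : seq (C * R)) (f : R -> C) :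
  (forall k : nat, \sum_(r <- s) r.1 * (expR (k%:R * r.2))%:C = 0) ->
  \sum_(r <- s) r.1 * f r.2 = 0.
Proof.
move=> s0.
have := @power_sums_eq0 _ _ s (fun r => r.1) (fun r => (expR r.2)%:C)
  (fun z => f (ln (complex.Re z))).
under eq_bigr do rewrite /= expRK.
apply=> k; rewrite -[RHS](s0 k); apply: eq_bigr => r _.
by rewrite expRM_natl rmorphXn.
Qed.

(** Along the powers, a vanishing polynomial is an exponential sum that is zero at all naturals.
    Replacing each exponential by its frequency gives the derivative at time 0. *)
Lemma tangent_of_powers (G : 'M[C]_N -> Prop) :
  (forall g, G g -> forall k : nat, G (g *m expW k%:R)) -> tangent G W.
Proof.
move=> GE e ve g Gg; have [s sP] := peval_exponential_sum e g.
have E0 : expW 0 = 1%:M.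
  by rewrite -(dconj1 UV); congr dconj; apply/funext => i; rewrite mul0r expR0.
have [_] := sP 0; rewrite E0 mulmx1 => ->.
under eq_bigr do rewrite mul0r expR0 mulr1.
apply: exponential_sum_apply => k; have [<- _] := sP k%:R.
exact/ve/GE.
Qed.

(** Iterated derivatives at the identity show that all weighted power sums of the frequencies
    vanish; replacing powers by [expR (t * a)] recovers the value at time [t]. *)
Lemma exponential_of_tangent (G : 'M[C]_N -> Prop) :
  (forall M, M \in unitmx -> (forall e, vanishing G e -> peval e M = 0) -> G M) ->
  G 1%:M -> tangent G W -> forall t, G (expW t).
Proof.
move=> Gclosed G1 tW t; apply: Gclosed.
  by apply: dconj_unit => // i; rewrite fmorph_eq0 gt_eqF ?expR_gt0.
move=> e ve; have [s sP] := peval_exponential_sum e 1%:M.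
pose D k := iter k (pder W) e.
have vD k : vanishing G (D k) by elim: k => //= k; apply: tW.
have DE k t' : peval (D k) (expW t') =
    \sum_(r <- s) r.1 * (r.2)%:C ^+ k * (expR (t' * r.2))%:C.
  elim: k t' => [|k IH] t'.
    by have [+ _] := sP t'; rewrite mul1mx => ->; under [RHS]eq_bigr do rewrite mulr1.
  have [s' s'P] := peval_exponential_sum (D k) 1%:M.
  have [_] := s'P t'; rewrite mul1mx /= -/(D k) => ->; apply/eqP; rewrite -subr_eq0.
  (* Both [s'] and [s] with coefficients multiplied by [a ^ k] represent the same function. Their
     difference vanishes at all naturals, hence so does its derivative at every time. *)
  pose s2 := s' ++ [seq (- (r.1 * (r.2)%:C ^+ k), r.2) | r <- s].
  have := @exponential_sum_apply s2 (fun a => a%:C * (expR (t' * a))%:C).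
  rewrite /s2 big_cat big_map /= => H; apply/eqP; rewrite -[RHS]H; last first.
    move=> n; rewrite big_cat big_map /=.
    have [+ _] := s'P n%:R; rewrite mul1mx => <-; rewrite IH -big_split /= big1 // => r _.
    by rewrite mulNr addrN.
  rewrite -sumrN; congr (_ + _); apply: eq_bigr => r _; rewrite ?exprSr; ring.
have := @power_sums_eq0 _ _ s (fun r => r.1) (fun r => (r.2)%:C)
  (fun z => (expR (t * complex.Re z))%:C).
have -> : peval e (expW t) = peval (D 0%N) (expW t) by [].
rewrite DE; under [in X in _ -> X]eq_bigr do rewrite mulr1.
apply=> k; have E0 : expW 0 = 1%:M.
  by rewrite -(dconj1 UV); congr dconj; apply/funext => i; rewrite mul0r expR0.
have := vD k _ G1; rewrite -E0 DE => H; rewrite -[RHS]H; apply: eq_bigr => r _.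
by rewrite mul0r expR0 mulr1.
Qed.

End OneParameterGroups.

(** * Hermitian matrices and Frobenius norms *)

Section ComplexMatrices.
Local Open Scope complex_scope.
Variable R : realType.
Local Notation C := (complex R).

Lemma adjE m n (A : 'M[C]_(m, n)) i j : adj A i j = (A j i)^*.
Proof. by rewrite !mxE. Qed.

Lemma adjK m n : cancel (@adj R m n) (@adj R n m).
Proof. by move=> A; apply/matrixP => i j; rewrite !adjE conjcK. Qed.

Lemma adjM m n p (A : 'M[C]_(m, n)) (B : 'M[C]_(n, p)) : adj (A *m B) = adj B *m adj A.
Proof. by rewrite /adj map_mxM trmx_mul. Qed.

Lemma adj1 n : adj (1%:M : 'M[C]_n) = 1%:M.
Proof. by rewrite /adj map_mx1 trmx1. Qed.

Lemma adj_dconj n (U : 'M[C]_n) (w : 'I_n -> R) :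
  adj (dconj U (adj U) (fun i => (w i)%:C)) = dconj U (adj U) (fun i => (w i)%:C).
Proof.
rewrite /dconj !adjM adjK mulmxA; congr (_ *m _ *m _); apply/matrixP => i j.
rewrite adjE !mxE eq_sym; case: eqP => [->|_]; first by rewrite mulr1n conjc_real.
by rewrite mulr0n conjc0.
Qed.

Lemma adj_invmx n (A : 'M[C]_n) : A \in unitmx -> adj (invmx A) = invmx (adj A).
Proof.
move=> uA; have e : adj (invmx A) *m adj A = 1%:M by rewrite -adjM mulmxV // adj1.
by have [_ u] := mulmx1_unit e; rewrite -[LHS](mulmxK u) e mul1mx.
Qed.

Lemma adj_unit n (A : 'M[C]_n) : A \in unitmx -> adj A \in unitmx.
Proof.
move=> uA; have e : adj (invmx A) *m adj A = 1%:M by rewrite -adjM mulmxV // adj1.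
by have [] := mulmx1_unit e.
Qed.

Lemma hermitian_diagonalization n (H : 'M[C]_n) : Defs.hermitian H ->
  exists U (w : 'I_n -> R), [/\ U *m adj U = 1%:M, adj U *m U = 1%:M &
    H = dconj U (adj U) (fun i => (w i)%:C)].
Proof.
move=> hH.
have adjT k l (M : 'M[C]_(k, l)) : map_mx Num.conj M^T = adj M.
  by apply/matrixP => i j; rewrite !mxE.
have /orthomx_spectralP : H \is normalmx by apply/normalmxP; rewrite !adjT hH.
set P := spectralmx H; set d := spectral_diag H.
have uP : P \in unitmx by apply: spectral_unit.
have PP : invmx P = adj P by rewrite invmx_unitary ?adjT ?spectral_unitarymx.
move=> eH; exists (adj P), (fun i => complex.Re (d 0 i)).
have U1 : adj P *m adj (adj P) = 1%:M by rewrite adjK -PP mulVmx.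
have U2 : adj (adj P) *m adj P = 1%:M by rewrite adjK -PP mulmxV.
split=> //; rewrite {1}eH PP /dconj adjK; congr (_ *m diag_mx _ *m _).
have dd : adj (diag_mx d) = diag_mx d.
  have : P *m H *m adj P = diag_mx d by rewrite eH PP !mulmxA -PP mulmxV // mul1mx -mulmxA mulmxV ?mulmx1.
  by move=> <-; rewrite !adjM adjK hH mulmxA.
apply/rowP => i; rewrite mxE; have /matrixP/(_ i i) := dd.
rewrite adjE !mxE eqxx mulr1n; case: (d 0 i) => a b /= [e]; congr Complex; lra.
Qed.

Lemma dconjX n (U V : 'M[C]_n) (w : 'I_n -> C) k : U *m V = 1%:M -> V *m U = 1%:M ->
  dconj U V w ^+ k = dconj U V (fun i => w i ^+ k).
Proof.
move=> UV VU; elim: k => [|k IH]; first by rewrite -[LHS]/(1%:M) -(dconj1 UV).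
have -> : dconj U V w ^+ k.+1 = dconj U V w *m dconj U V w ^+ k.
  exact: exprS.
rewrite IH (dconjM _ _ VU).
congr dconj; apply/funext => i.
by rewrite -exprS.
Qed.

Lemma expm_dconj n (U V : 'M[C]_n) (w : 'I_n -> R) : U *m V = 1%:M -> V *m U = 1%:M ->
  expm (dconj U V (fun i => (w i)%:C)) = dconj U V (fun i => (expR (w i))%:C).
Proof.
move=> UV VU; set H := dconj _ _ _.
have part N i j : expm_partial H N i j =
    \sum_k (U i k * V k j) * (series (exp_coeff (w k)) N)%:C.
  rewrite /expm_partial summxE.
  under eq_bigr do rewrite mxE dconjX // dconjE mulr_sumr.
  rewrite exchange_big; apply: eq_bigr => k _ /=.
  rewrite /series /= big_mkord rmorph_sum mulr_sumr; apply: eq_bigr => l _.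
  rewrite /exp_coeff /= rmorphM rmorphXn /= fmorphV rmorph_nat; ring.
have ReM (x : C) (r : R) : complex.Re (x * r%:C) = complex.Re x * r.
  by case: x => a b /=; rewrite mulr0 subr0.
have ImM (x : C) (r : R) : complex.Im (x * r%:C) = complex.Im x * r.
  by case: x => a b /=; rewrite mulr0 add0r.
have cv (a : 'I_n -> R) : ((\sum_k a k * series (exp_coeff (w k)) N) @[N --> \oo] -->
    (\sum_k a k * expR (w k)))%classic.
  apply: cvg_big => [|k _]; first exact: add_continuous.
  by apply: cvgM; [exact: cvg_cst|exact: is_cvg_series_exp_coeff].
apply/matrixP => i j; rewrite mxE dconjE.
transitivity (\sum_k (U i k * V k j) * (expR (w k))%:C); last first.
  by apply: eq_bigr => k _; rewrite mulrAC.
have ReS (f : 'I_n -> C) : complex.Re (\sum_k f k) = \sum_k complex.Re (f k).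
  by apply: (big_morph (@complex.Re R) (id1 := 0)) => // -[a b] [c d].
have ImS (f : 'I_n -> C) : complex.Im (\sum_k f k) = \sum_k complex.Im (f k).
  by apply: (big_morph (@complex.Im R) (id1 := 0)) => // -[a b] [c d].
apply/eqP; rewrite eq_complex /= ReS ImS; apply/andP; split; apply/eqP.
  under [RHS]eq_bigr do rewrite ReM.
  under eq_fun do rewrite part ReS.
  under eq_fun do under eq_bigr do rewrite ReM.
  exact/cvg_lim/cv.
under [RHS]eq_bigr do rewrite ImM.
under eq_fun do rewrite part ImS.
under eq_fun do under eq_bigr do rewrite ImM.
exact/cvg_lim/cv.
Qed.

End ComplexMatrices.

Section Frobenius.
Local Open Scope complex_scope.
Variable R : realType.
Local Notation C := (complex R).

Definition normsq (z : C) : R := (complex.Re z) ^+ 2 + (complex.Im z) ^+ 2.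

Lemma normsq_ge0 z : 0 <= normsq z.
Proof. by rewrite addr_ge0 ?sqr_ge0. Qed.

Lemma normsqE z : (normsq z)%:C = z^* * z.
Proof. by case: z => a b; apply/eqP; rewrite eq_complex /normsq /=; apply/andP; split; apply/eqP; ring. Qed.

Lemma frob_ge0 m n (A : 'M[C]_(m, n)) : 0 <= frob A.
Proof. exact: sqrtr_ge0. Qed.

Lemma frob_sqr m n (A : 'M[C]_(m, n)) : frob A ^+ 2 = \sum_i \sum_j normsq (A i j).
Proof.
by rewrite sqr_sqrtr //; apply: sumr_ge0 => i _; apply: sumr_ge0 => j _; apply: normsq_ge0.
Qed.

Lemma frob_eq0 m n (A : 'M[C]_(m, n)) : frob A = 0 -> A = 0.
Proof.
move=> A0; have := frob_sqr A; rewrite A0 expr0n /= => /esym /eqP.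
rewrite psumr_eq0; last by move=> i _; apply: sumr_ge0 => j _; apply: normsq_ge0.
move=> /allP H; apply/matrixP => i j; rewrite mxE.
have := H i (mem_index_enum _) => /=; rewrite psumr_eq0 => [/allP|]; last by move=> *; apply: normsq_ge0.
move=> /(_ j (mem_index_enum _)) /=; rewrite /normsq paddr_eq0 ?sqr_ge0 // !sqrf_eq0.
by case: (A i j) => a b /= /andP[/eqP-> /eqP->].
Qed.

Lemma frob_sqr_trace m n (A : 'M[C]_(m, n)) : (frob A ^+ 2)%:C = \tr (adj A *m A).
Proof.
rewrite frob_sqr exchange_big rmorph_sum; apply: eq_bigr => j _ /=.
rewrite rmorph_sum mxE; apply: eq_bigr => i _ /=.
by rewrite normsqE adjE.
Qed.

Lemma cauchy_schwarz_sum (I : finType) (x y : I -> R) :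
  (\sum_i x i * y i) ^+ 2 <= (\sum_i x i ^+ 2) * (\sum_i y i ^+ 2).
Proof.
have expand (a b : R) : \sum_i (a * x i - b * y i) ^+ 2 =
    a ^+ 2 * (\sum_i x i ^+ 2) - (2 * a * b) * (\sum_i x i * y i) +
    b ^+ 2 * (\sum_i y i ^+ 2).
  by rewrite !mulr_sumr -sumrB -big_split; apply: eq_bigr => i _ /=; ring.
set S := \sum_i _ * _; set X := \sum_i x i ^+ 2; set Y := \sum_i y i ^+ 2.
have Y0 : 0 <= Y by apply: sumr_ge0 => i _; apply: sqr_ge0.
have [Y00|Ypos] := eqVneq Y 0.
  have y0 i : y i = 0.
    apply/eqP; rewrite -sqrf_eq0; apply/eqP.
    by move/eqP: Y00; rewrite psumr_eq0 => [/allP/(_ i (mem_index_enum _))/eqP|*]; rewrite ?sqr_ge0.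
  by rewrite /S big1 ?Y00 ?mulr0 ?expr0n // => i _; rewrite y0 mulr0.
have {}Ypos : 0 < Y by rewrite lt_neqAle eq_sym Ypos.
have : 0 <= \sum_i (Y * x i - S * y i) ^+ 2 by apply: sumr_ge0 => i _; apply: sqr_ge0.
have -> : \sum_i (Y * x i - S * y i) ^+ 2 = Y * (X * Y - S ^+ 2).
  by rewrite expand -/S -/X -/Y; ring.
by rewrite pmulr_rge0 // subr_ge0.
Qed.

Lemma Re_trace_le m n (A : 'M[C]_(m, n)) (B : 'M[C]_(n, m)) :
  complex.Re (\tr (A *m B)) ^+ 2 <= frob A ^+ 2 * frob B ^+ 2.
Proof.
have ReD (x y : C) : complex.Re (x + y) = complex.Re x + complex.Re y.
  by case: x y => [a b] [c d].
have ReS (I : finType) (f : I -> C) : complex.Re (\sum_k f k) = \sum_k complex.Re (f k).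
  exact: (big_morph (@complex.Re R) ReD).
have split_sum (f : 'I_m * 'I_n -> bool -> R) :
    \sum_i \sum_j (f (i, j) true + f (i, j) false) = \sum_(k : ('I_m * 'I_n) * bool) f k.1 k.2.
  transitivity (\sum_(p : 'I_m * 'I_n) (f p true + f p false)).
    by rewrite pair_bigA; apply: eq_bigr => -[].
  by rewrite -(pair_bigA _ (fun k b => f k b)); apply: eq_bigr => p _; rewrite big_bool.
rewrite !frob_sqr [X in _ * X]exchange_big /=.
(* The boolean selects real or imaginary parts; the sign reflects
   [Re (z w) = Re z Re w - Im z Im w]. *)
pose x (k : ('I_m * 'I_n) * bool) :=
  if k.2 then complex.Re (A k.1.1 k.1.2) else - complex.Im (A k.1.1 k.1.2).
pose y (k : ('I_m * 'I_n) * bool) :=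
  if k.2 then complex.Re (B k.1.2 k.1.1) else complex.Im (B k.1.2 k.1.1).
have split_sum' (h : ('I_m * 'I_n) * bool -> R) :
    \sum_i \sum_j (h ((i, j), true) + h ((i, j), false)) = \sum_k h k.
  by rewrite (split_sum (fun p b => h (p, b))); apply: eq_bigr => -[].
have -> : \sum_i \sum_j normsq (A i j) = \sum_k x k ^+ 2.
  rewrite -split_sum'; apply: eq_bigr => i _; apply: eq_bigr => j _.
  by rewrite /x /= sqrrN.
have -> : \sum_j \sum_i normsq (B i j) = \sum_k y k ^+ 2.
  by rewrite -split_sum'; apply: eq_bigr => i _; apply: eq_bigr => j _.
have -> : complex.Re (\tr (A *m B)) = \sum_k x k * y k.
  rewrite -split_sum' ReS; apply: eq_bigr => i _; rewrite mxE ReS.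
  apply: eq_bigr => j _; rewrite /x /y /=.
  by case: (A i j) (B j i) => [a b] [c d] /=; rewrite mulNr.
exact: cauchy_schwarz_sum.
Qed.

Lemma frob_adj m n (A : 'M[C]_(m, n)) : frob (adj A) ^+ 2 = frob A ^+ 2.
Proof.
rewrite !frob_sqr exchange_big; apply: eq_bigr => i _; apply: eq_bigr => j _ /=.
by rewrite adjE; case: (A i j) => a b; rewrite /normsq /= sqrrN.
Qed.

Lemma cinner_self n (H : 'M[C]_n) : cinner H H = frob H ^+ 2.
Proof. by rewrite /cinner -frob_sqr_trace. Qed.

Lemma inner2_cauchy_schwarz m n (H H' : 'M[C]_m * 'M[C]_n) :
  inner2 H H' ^+ 2 <= inner2 H H * inner2 H' H'.
Proof.
rewrite /inner2 !cinner_self.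
have := Re_trace_le (adj H.1) H'.1; have := Re_trace_le (adj H.2) H'.2.
rewrite !frob_adj -/(cinner _ _) -/(cinner _ _).
move: (cinner H.1 _) (cinner H.2 _) => a b.
move: (frob_ge0 H.1) (frob_ge0 H.2) (frob_ge0 H'.1) (frob_ge0 H'.2).
move: (frob H.1) (frob H.2) (frob H'.1) (frob H'.2) => u v u' v' u0 v0 u'0 v'0 hb ha.
have ha' : `|a| <= u * u' by rewrite -ler_sqr ?nnegrE ?mulr_ge0 // real_normK ?num_real // exprMn.
have hb' : `|b| <= v * v' by rewrite -ler_sqr ?nnegrE ?mulr_ge0 // real_normK ?num_real // exprMn.
apply: (@le_trans _ _ ((u * u' + v * v') ^+ 2)).
  rewrite -[X in X <= _]real_normK ?num_real // ler_sqr ?nnegrE ?addr_ge0 ?mulr_ge0 //.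
  exact: le_trans (ler_normD _ _) (lerD ha' hb').
have := sqr_ge0 (u * v' - v * u'); nra.
Qed.

Lemma frob_sqr_dconj n (U : 'M[C]_n) (w : 'I_n -> R) : adj U *m U = 1%:M ->
  frob (dconj U (adj U) (fun i => (w i)%:C)) ^+ 2 = \sum_i w i ^+ 2.
Proof.
move=> UU; apply: (@complexI R); rewrite frob_sqr_trace adj_dconj (dconjM _ _ UU).
rewrite /dconj -mulmxA mxtrace_mulC -mulmxA UU mulmx1 mxtrace_diag rmorph_sum.
by apply: eq_bigr => i _; rewrite mxE rmorphXn /= expr2.
Qed.

(** Only [X^* X] and [Y^* Y] enter, so the unitary parts of [X] and [Y] drop out. This treats
    geodesics and arbitrary competitors alike. *)
Lemma frob_sqr_polar m n (B : 'M[C]_(m, n)) (X U : 'M[C]_m) (Y U' : 'M[C]_n)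
    (x : 'I_m -> R) (y : 'I_n -> R) :
  Y \in unitmx -> U' *m adj U' = 1%:M -> adj U' *m U' = 1%:M ->
  adj X *m X = dconj U (adj U) (fun i => (expR (2 * x i))%:C) ->
  adj Y *m Y = dconj U' (adj U') (fun j => (expR (2 * y j))%:C) ->
  frob (X *m B *m invmx Y) ^+ 2 =
  \sum_i \sum_j normsq ((adj U *m B *m U') i j) * expR (2 * (x i - y j)).
Proof.
move=> uY UU1 UU2 hX hY; apply: (@complexI R); rewrite frob_sqr_trace.
have iY : invmx Y *m adj (invmx Y) = dconj U' (adj U') (fun j => (expR (- (2 * y j)))%:C).
  rewrite (adj_invmx uY); set D := dconj _ _ _.
  have DY : D *m (adj Y *m Y) = 1%:M.
    rewrite hY (dconjM _ _ UU2) -[RHS](dconj1 UU1); congr dconj; apply/funext => j.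
    by rewrite -rmorphM /= -expRD addNr expR0.
  rewrite -[RHS]mulmx1 -(mulmxV (adj_unit uY)) -[X in D *m (X *m _)]mulmx1 -(mulmxV uY).
  by rewrite !mulmxA -(mulmxA D) DY mul1mx.
rewrite !adjM -!mulmxA mxtrace_mulC !mulmxA.
rewrite -(mulmxA _ (adj X) X) hX -(mulmxA _ (invmx Y)) iY /dconj.
set b := adj U *m B *m U'.
transitivity (\tr (adj b *m diag_mx (\row_i (expR (2 * x i))%:C) *m b *m
    diag_mx (\row_j (expR (- (2 * y j)))%:C))).
  by rewrite !mulmxA mxtrace_mulC /b !adjM adjK !mulmxA.
rewrite exchange_big rmorph_sum; apply: eq_bigr => j _ /=.
rewrite rmorph_sum mul_mx_diag !mxE mulr_suml; apply: eq_bigr => i _ /=.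
rewrite [RHS]rmorphM /= normsqE mul_mx_diag mxE adjE [(\row__ _) _ _]mxE mulrBr expRD rmorphM /=; ring.
Qed.

End Frobenius.

(** * Symmetric groups of pairs containing the torus *)

Section PairsAsBlockMatrices.
Local Open Scope complex_scope.
Local Open Scope classical_set_scope.
Variables (R : realType) (m n : nat).
Local Notation C := (complex R).

Definition block_diag2 (F : pzRingType) (g : 'M[F]_m * 'M[F]_n) : 'M[F]_(m + n) :=
  block_mx g.1 0 0 g.2.

Definition join_ord T (x : 'I_m -> T) (y : 'I_n -> T) (k : 'I_(m + n)) : T :=
  match fintype.split k with inl i => x i | inr j => y j end.

Lemma join_ord_comp T T' (f : T -> T') x y :
  (fun k => f (join_ord x y k)) = join_ord (fun i => f (x i)) (fun j => f (y j)).
Proof. by apply/funext => k; rewrite /join_ord; case: fintype.split. Qed.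

Lemma dconj_block_diag2 (F : comNzRingType) (U V : 'M[F]_m * 'M[F]_n) x y :
  dconj (block_diag2 U) (block_diag2 V) (join_ord x y) =
  block_diag2 (dconj U.1 V.1 x, dconj U.2 V.2 y).
Proof.
rewrite /dconj /block_diag2 /=.
have -> : \row_k join_ord x y k = row_mx (\row_i x i) (\row_j y j).
  by apply/rowP => k; rewrite !mxE /join_ord; case: fintype.split => ?; rewrite !mxE.
by rewrite diag_mx_row !mulmx_block !(mulmx0, mul0mx, addr0, add0r).
Qed.

Lemma block_diag2_inj (F : pzRingType) : injective (@block_diag2 F).
Proof. by move=> [X Y] [X' Y'] /eq_block_mx[/= -> _ _ ->]. Qed.

Lemma block_diag2M (F : pzRingType) (g h : 'M[F]_m * 'M[F]_n) :
  block_diag2 g *m block_diag2 h = block_diag2 (g.1 *m h.1, g.2 *m h.2).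
Proof. by rewrite mulmx_block !(mulmx0, mul0mx, addr0, add0r). Qed.

Lemma block_diag2_1 (F : pzRingType) : block_diag2 (1%:M, 1%:M) = 1%:M :> 'M[F]_(m + n).
Proof. by rewrite /block_diag2 /= -scalar_mx_block. Qed.

Lemma polyfun_pexpr (p : 'M[C]_m * 'M[C]_n -> C) : polyfun (@pair_coords R m n) p ->
  exists e : pexpr C (m + n), forall g, peval e (block_diag2 g) = p g.
Proof.
elim=> [c|f|f h _ [e1 IH1] _ [e2 IH2]|f h _ [e1 IH1] _ [e2 IH2]].
- by exists (PConst _ c).
- case=> -[i [j ->]].
    by exists (PCoord _ (lshift n i) (lshift n j)) => g; rewrite /= block_mxEul.
  by exists (PCoord _ (rshift m i) (rshift m j)) => g; rewrite /= block_mxEdr.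
- by exists (PAdd e1 e2) => g; rewrite /= IH1 IH2.
- by exists (PMul e1 e2) => g; rewrite /= IH1 IH2.
Qed.

Variable G : set ('M[C]_m * 'M[C]_n).
Hypothesis symG : symmetric2 G.

Definition block_image (M : 'M[C]_(m + n)) := exists2 g, G g & M = block_diag2 g.

Lemma block_image_G g : block_image (block_diag2 g) -> G g.
Proof. by case=> h Gh /block_diag2_inj ->. Qed.

(** The off-diagonal coordinates vanish on the image, which forces [M] to be block diagonal; the
    equations of [G] then apply to its blocks. *)
Lemma block_image_closed M : M \in unitmx ->
  (forall e, vanishing block_image e -> peval e M = 0) -> block_image M.
Proof.
move=> uM van; have [_ [S [Spoly SG]] _] := symG.
pose X := ulsubmx M; pose Y := drsubmx M.
have eM : M = block_diag2 (X, Y).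
  rewrite -[LHS]submxK /block_diag2 /=; congr block_mx; apply/matrixP => i j; rewrite !mxE.
    apply: (van (PCoord _ (lshift n i) (rshift m j))) => _ [g Gg ->] /=.
    by rewrite block_mxEur mxE.
  apply: (van (PCoord _ (rshift m i) (lshift n j))) => _ [g Gg ->] /=.
  by rewrite block_mxEdl mxE.
exists (X, Y) => //; apply/SG; split=> [|p Sp].
  by move: uM; rewrite eM unitmxE det_ublock unitrM -!unitmxE => /andP[].
have [e eP] := polyfun_pexpr (Spoly p Sp).
rewrite -eP -eM; apply: van => _ [g Gg ->]; rewrite eP.
by have /SG[_] := Gg; apply.
Qed.

(* Case (ii) is handled by padding the group with a trivial second factor. *)
Definition torus_dichotomy := torus_in2 G \/
  ((forall X, is_diag_mx X -> X \in unitmx -> G (X, 1%:M)) /\ forall g, G g -> g.2 = 1%:M).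

Hypothesis torusG : torus_dichotomy.

(** Exponentials of [E_kk] are diagonal. An index of the second block needs the full torus; for one
    of the first block the second factor stays the identity, which either side of the dichotomy
    allows. *)
Lemma tangent_torus_block (k : 'I_(m + n)) :
  (forall j, k = rshift m j -> torus_in2 G) -> tangent block_image (delta_mx k k).
Proof.
move=> kact; have [[_ G1 GM _] _ _] := symG.
pose w (i : 'I_(m + n)) : R := (i == k)%:R.
have -> : delta_mx k k = dconj 1%:M 1%:M (fun i => (w i)%:C).
  rewrite /dconj mul1mx mulmx1; apply/matrixP => i j; rewrite !mxE /w.
  by case: (eqVneq i j) => [->|ij]; case: (eqVneq _ k) => [ik|ik] //=;
    rewrite ?mulr1n ?mulr0n ?rmorph1 ?rmorph0 //; rewrite -ik eq_sym (negPf ij).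
apply: tangent_of_powers; rewrite ?mulmx1 // => _ [g Gg ->] l.
pose z i := (expR (l%:R * w i))%:C.
have z0 i : z i != 0 by rewrite fmorph_eq0 gt_eqF ?expR_gt0.
have du q (d : 'I_q -> C) : (forall i, d i != 0) ->
    is_diag_mx (diag_mx (\row_i d i)) /\ diag_mx (\row_i d i) \in unitmx.
  move=> d0; rewrite diag_mx_is_diag unitmxE det_diag unitfE; split=> //.
  by apply/prodf_neq0 => i _; rewrite mxE.
have zz : z = join_ord (fun i => z (lshift n i)) (fun j => z (rshift m j)).
  apply/funext => i; rewrite /join_ord -[in LHS](splitK i).
  by case: fintype.split => ?.
have := @dconj_block_diag2 _ (1%:M, 1%:M) (1%:M, 1%:M) (fun i => z (lshift n i)) (fun j => z (rshift m j)).
rewrite -zz !block_diag2_1 /= => ->; rewrite block_diag2M /=.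
pose d := (diag_mx (\row_i z (lshift n i)), diag_mx (\row_j z (rshift m j))).
exists (g.1 *m d.1, g.2 *m d.2); last by rewrite /dconj !mulmx1 !mul1mx.
apply: (GM g d) => //; rewrite /d.
have [d1 u1] := du _ _ (fun i => z0 (lshift n i)).
have [d2 u2] := du _ _ (fun j => z0 (rshift m j)).
case: torusG => [tG|[tG _]]; first exact: tG.
have [[j kj]|nk] := pselect (exists j, k = rshift m j); first exact: kact kj _ _ _ _ _ _.
have -> : diag_mx (\row_j z (rshift m j)) = 1%:M.
  rewrite -diag_const_mx; congr diag_mx; apply/rowP => j; rewrite !mxE /z /w.
  case: eqP => [kj|_]; first by case: nk; exists j.
  by rewrite mulr0 expR0.
exact: tG.
Qed.

Lemma expm_scale_dconj q (U : 'M[C]_q) (w : 'I_q -> R) t :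
  U *m adj U = 1%:M -> adj U *m U = 1%:M ->
  expm (t%:C *: dconj U (adj U) (fun i => (w i)%:C)) =
  dconj U (adj U) (fun i => (expR (t * w i))%:C).
Proof.
move=> U1 U2; rewrite -(expm_dconj _ U1 U2); congr expm; apply/matrixP => i j.
rewrite [RHS]dconjE [LHS]mxE.
rewrite [X in _ * X]dconjE.
rewrite mulr_sumr; apply: eq_bigr => k _.
by rewrite rmorphM /= !mulrA [t%:C * _]mulrC.
Qed.

(* [x] and [y] are half the logarithms of the spectrum of [(h.1^* h.1, h.2^* h.2)]; every function of the two spectra is again a direction of [G], because [Lie G] is a sum of root spaces of the torus, so that its two blocks are closed under products. *)
Lemma spectral_direction (h : 'M[C]_m * 'M[C]_n) (U : 'M[C]_m) (U' : 'M[C]_n)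
    (x : 'I_m -> R) (y : 'I_n -> R) (f f' : R -> R) :
  G h -> U *m adj U = 1%:M -> adj U *m U = 1%:M ->
  U' *m adj U' = 1%:M -> adj U' *m U' = 1%:M ->
  adj h.1 *m h.1 = dconj U (adj U) (fun i => (expR (2 * x i))%:C) ->
  adj h.2 *m h.2 = dconj U' (adj U') (fun j => (expR (2 * y j))%:C) ->
  torus_in2 G \/ (forall j, y j = 0) /\ (forall j, f' (y j) = 0) ->
  iLieK2 G (dconj U (adj U) (fun i => (f (x i))%:C),
            dconj U' (adj U') (fun j => (f' (y j))%:C)).
Proof.
move=> Gh U1 U2 U'1 U'2 hx hy tor; have [[_ G1 GM _] _ Gadj] := symG.
split; last by split; exact: adj_dconj.
pose UU := block_diag2 (U, U'); pose VV := block_diag2 (adj U, adj U').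
have UV : UU *m VV = 1%:M by rewrite block_diag2M /= U1 U'1 block_diag2_1.
have VU : VV *m UU = 1%:M by rewrite block_diag2M /= U2 U'2 block_diag2_1.
have joinC (a : 'I_m -> R) (b : 'I_n -> R) : dconj UU VV (fun k => (join_ord a b k)%:C) =
    block_diag2 (dconj U (adj U) (fun i => (a i)%:C), dconj U' (adj U') (fun j => (b j)%:C)).
  by rewrite (join_ord_comp (real_complex R)) dconj_block_diag2.
pose w := join_ord (fun i => 2 * x i) (fun j => 2 * y j).
have expw t : dconj UU VV (fun k => (expR (t * w k))%:C) =
    block_diag2 (dconj U (adj U) (fun i => (expR (t * (2 * x i)))%:C),
                 dconj U' (adj U') (fun j => (expR (t * (2 * y j)))%:C)).
  by rewrite (join_ord_comp (fun a => (expR (t * a))%:C)) dconj_block_diag2.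
(* Powers of [h^* h] stay in [G] by closure under adjoint and product, so its logarithm is
   tangent. *)
have tH : tangent block_image (dconj UU VV (fun k => (w k)%:C)).
  apply: tangent_of_powers => // g Gg l.
  elim: l => [|l IH].
    have -> : dconj UU VV (fun k => (expR (0%:R * w k))%:C) = 1%:M.
      by rewrite -(dconj1 UV); congr dconj; apply/funext => k; rewrite mul0r expR0.
    by rewrite mulmx1.
  have -> : dconj UU VV (fun k => (expR (l.+1%:R * w k))%:C) =
      dconj UU VV (fun k => (expR (l%:R * w k))%:C) *m dconj UU VV (fun k => (expR (1 * w k))%:C).
    rewrite (dconjM _ _ VU); congr dconj; apply/funext => k.
    by rewrite -rmorphM -expRD -mulrDl natr1.
  rewrite mulmxA; case: IH => g' Gg' ->.
  rewrite expw; under eq_fun do rewrite mul1r; rewrite -hx.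
  under [fun j : 'I_n => _]eq_fun do rewrite mul1r; rewrite -hy block_diag2M.
  exists (g'.1 *m (adj h.1 *m h.1), g'.2 *m (adj h.2 *m h.2)) => //.
  by apply: (GM g' (_ *m _, _ *m _) Gg'); apply: (GM _ _ (Gadj _ Gh) Gh).
pose act (k : 'I_(m + n)) := `[< forall j, k = rshift m j -> torus_in2 G >].
have tact k : act k -> tangent block_image (delta_mx k k).
  by move=> /asboolP; apply: tangent_torus_block.
have zero_row (a : 'I_m -> R) (b : 'I_n -> R) k l : (torus_in2 G \/ forall j, b j = 0) ->
    ~~ act k || ~~ act l ->
    dconj UU VV (fun k => (join_ord a b k)%:C) k l = 0.
  rewrite joinC => -[tG|b0]; first by case/orP => /asboolP[].
  have -> : dconj U' (adj U') (fun j => (b j)%:C) = 0.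
    apply/matrixP => i j; rewrite dconjE mxE big1 // => r _.
    by rewrite b0 mulr0 mul0r.
  rewrite /block_diag2 /= -[k]splitK -[l]splitK.
  case: (fintype.split k) => [i|i] /=; case: (fintype.split l) => [j|j] /=.
  - by case/orP => /asboolP[] j' /eqP; rewrite eq_lrshift.
  - by rewrite block_mxEur mxE.
  - by rewrite block_mxEdl mxE.
  - by rewrite block_mxEdr mxE.
have sH : root_supported block_image (dconj UU VV (fun k => (w k)%:C)).
  move=> k l kl Hkl; have [a|na] := boolP (act k && act l).
    by case/andP: a => ak al; exact: (tangent_root tact ak al kl tH Hkl).
  move: Hkl; rewrite zero_row ?eqxx //; last by rewrite -negb_and.
  by case: tor => [|[y0 _]]; [left|right => j; rewrite y0 mulr0].
have sF (u : R -> R) : root_supported block_image (dconj UU VV (fun k => (u (w k / 2))%:C)).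
  have := root_supported_functional_calculus (f := fun z => (u (complex.Re z / 2))%:C) UV VU sH.
  exact.
pose WW := dconj UU VV (fun k => (join_ord (fun i => f (x i)) (fun j => f' (y j)) k)%:C).
have tW : tangent block_image WW.
  apply: (root_supported_tangent tact); last first.
    move=> k nk; apply: zero_row; last by rewrite nk.
    by case: tor => [|[_ ?]]; [left|right].
  move=> k l kl; rewrite /WW joinC => Wkl.
  (* The calculus applies one function [u] to both spectra; as the support is read entry by entry,
     [f] may serve for the first block and [f'] for the second. *)
  have sF' u : root_supported block_image (block_diag2
      (dconj U (adj U) (fun i => (u (x i))%:C), dconj U' (adj U') (fun j => (u (y j))%:C))).
    rewrite -joinC; have := sF u; congr root_supported; congr dconj.
    by apply/funext => r; rewrite /w /join_ord; case: fintype.split => s; rewrite mulrAC divff ?mul1r ?pnatr_eq0.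
  move: kl Wkl; rewrite -[k]splitK -[l]splitK.
  case: (fintype.split k) => [i|i] /=; case: (fintype.split l) => [j|j] /= kl.
  - rewrite /block_diag2 block_mxEul /= => Wij; apply: (sF' f) => //.
    by rewrite /block_diag2 block_mxEul.
  - by rewrite /block_diag2 block_mxEur mxE eqxx.
  - by rewrite /block_diag2 block_mxEdl mxE eqxx.
  - rewrite /block_diag2 block_mxEdr /= => Wij; apply: (sF' f') => //.
    by rewrite /block_diag2 block_mxEdr.
move=> t; rewrite /= !expm_scale_dconj //; apply: block_image_G.
have -> : block_diag2 (dconj U (adj U) (fun i => (expR (t * f (x i)))%:C),
    dconj U' (adj U') (fun j => (expR (t * f' (y j)))%:C)) =
    dconj UU VV (fun k => (expR (t * join_ord (fun i => f (x i)) (fun j => f' (y j)) k))%:C).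
  by rewrite (join_ord_comp (fun a => (expR (t * a))%:C)) dconj_block_diag2.
apply: exponential_of_tangent => //; first exact: block_image_closed.
by rewrite -block_diag2_1; exists (1%:M, 1%:M).
Qed.

End PairsAsBlockMatrices.

(** * The objective along geodesics *)

Lemma is_derive_ln_sum_expR (R : realType) (I : finType) (P a : I -> R) :
  0 < \sum_k P k ->
  is_derive (0 : R) (1 : R) (fun t => ln (\sum_k P k * expR (t * a k)))
    ((\sum_k P k * a k) / \sum_k P k).
Proof.
move=> P0; pose S t := \sum_k P k * expR (t * a k).
have S0 : S 0 = \sum_k P k.
  by apply: eq_bigr => k _; rewrite mul0r expR0 mulr1.
have dS : is_derive (0 : R) (1 : R) S (\sum_k P k * a k).
  have -> : S = \sum_k (fun t => P k * expR (t * a k)).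
    by apply/funext => t; rewrite fct_sumE.
  elim/big_ind2: _ => [|u f v g|k _]; [exact: is_derive_cst|exact: is_deriveD|].
  have dl : is_derive (0 : R) (1 : R) (fun t => t * a k) (a k).
    have -> : (fun t : R => t * a k) = a k \*: id by apply/funext => t; rewrite /= mulrC.
    by apply: is_derive_eq; rewrite scaler1.
  have de := @is_derive1_comp _ expR (fun t => t * a k) 0 _ _ (is_derive_expR (0 * a k)) dl.
  rewrite mul0r expR0 mul1r in de.
  have -> : (fun t => P k * expR (t * a k)) = P k \*: (expR \o (fun t => t * a k)) by [].
  exact: is_deriveZ.
have dln : is_derive (S 0) (1 : R) (@ln R) (S 0)^-1 by apply: is_derive1_ln; rewrite S0.
have -> : (\sum_k P k * a k) / \sum_k P k = (S 0)^-1 * (\sum_k P k * a k).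
  by rewrite S0 mulrC.
exact: (@is_derive1_comp _ (@ln R) S 0 _ _ dln dS).
Qed.

Section KempfNess.
Local Open Scope complex_scope.
Local Open Scope classical_set_scope.
Variables (R : realType) (m n : nat).
Local Notation C := (complex R).
Variables (A : 'M[C]_(m, n)) (Ad : 'M[C]_(n, m)).

Lemma invmx_mul q (X Y : 'M[C]_q) : X \in unitmx -> Y \in unitmx ->
  invmx (X *m Y) = invmx Y *m invmx X.
Proof.
move=> uX uY; have uXY : X *m Y \in unitmx by rewrite unitmx_mul uX.
have e : invmx Y *m invmx X *m (X *m Y) = 1%:M.
  by rewrite -mulmxA (mulmxA _ X) (mulVmx uX) mul1mx mulVmx.
by rewrite -[RHS](mulmxK uXY) e mul1mx.
Qed.

(** The trace of [(X A Y^-1) (Y A^+ X^-1)] is that of the projection [A A^+], whatever [X] and [Y],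
    and Cauchy-Schwarz bounds it by the product of the norms. Positivity keeps the logarithms
    meaningful. *)
Lemma kappaT2_lower_bound : is_pinv A Ad -> A != 0 -> exists2 k0 : R, 0 < k0 &
  forall g, GL2 g -> k0 <= kappaT2 A Ad g.
Proof.
move=> [AAdA _ hAAd _] A0; exists (frob (A *m Ad) ^+ 2).
  rewrite exprn_gt0 // lt_neqAle frob_ge0 andbT eq_sym; apply: contra_neq A0.
  by move=> /frob_eq0 E; rewrite -AAdA E mul0mx.
move=> [X Y] [/= uX uY]; rewrite /kappaT2 /=.
have := Re_trace_le (X *m A *m invmx Y) (Y *m Ad *m invmx X).
have -> : \tr (X *m A *m invmx Y *m (Y *m Ad *m invmx X)) = (frob (A *m Ad) ^+ 2)%:C.
  rewrite frob_sqr_trace hAAd !mulmxA AAdA mxtrace_mulC !mulmxA mulVmx // mul1mx.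
  by rewrite -(mulmxA A) mulVmx // mulmx1.
by rewrite -exprMn ler_sqr ?nnegrE ?mulr_ge0 ?frob_ge0 ?exprn_ge0 ?frob_ge0.
Qed.

Definition weight (B : 'M[C]_(m, n)) (k : 'I_m * 'I_n) : R := normsq (B k.1 k.2).

Lemma weight_ge0 B k : 0 <= weight B k.
Proof. exact: normsq_ge0. Qed.

(** The weights depend only on [g] and the eigenbases. Transposing the second factor indexes both
    families by the same pairs. *)
Lemma kappaT2_polar (g h : 'M[C]_m * 'M[C]_n) (U : 'M[C]_m) (U' : 'M[C]_n)
    (x : 'I_m -> R) (y : 'I_n -> R)
    (P := weight (adj U *m (g.1 *m A *m invmx g.2) *m U'))
    (Q := weight (adj U' *m (g.2 *m Ad *m invmx g.1) *m U)^T) :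
  GL2 g -> GL2 h ->
  U *m adj U = 1%:M -> adj U *m U = 1%:M ->
  U' *m adj U' = 1%:M -> adj U' *m U' = 1%:M ->
  adj h.1 *m h.1 = dconj U (adj U) (fun i => (expR (2 * x i))%:C) ->
  adj h.2 *m h.2 = dconj U' (adj U') (fun j => (expR (2 * y j))%:C) ->
  kappaT2 A Ad (h.1 *m g.1, h.2 *m g.2) ^+ 2 =
  (\sum_k P k * expR (2 * (x k.1 - y k.2))) * (\sum_k Q k * expR (2 * (y k.2 - x k.1))).
Proof.
move=> [ug1 ug2] [uh1 uh2] U1 U2 U'1 U'2 hx hy; rewrite /kappaT2 /= exprMn.
congr (_ * _).
  have -> : h.1 *m g.1 *m A *m invmx (h.2 *m g.2) =
      h.1 *m (g.1 *m A *m invmx g.2) *m invmx h.2 by rewrite invmx_mul // !mulmxA.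
  rewrite (frob_sqr_polar _ uh2 U'1 U'2 hx hy) pair_bigA /=.
  by apply: eq_bigr => -[].
have -> : h.2 *m g.2 *m Ad *m invmx (h.1 *m g.1) =
    h.2 *m (g.2 *m Ad *m invmx g.1) *m invmx h.1 by rewrite invmx_mul // !mulmxA.
rewrite (frob_sqr_polar _ uh1 U1 U2 hy hx) exchange_big pair_bigA /=.
by apply: eq_bigr => -[i j] _; rewrite /Q /weight /= [(_ ^T) _ _]mxE.
Qed.

Lemma kappaT2_geodesic (g : 'M[C]_m * 'M[C]_n) (U : 'M[C]_m) (U' : 'M[C]_n)
    (w : 'I_m -> R) (w' : 'I_n -> R)
    (P := weight (adj U *m (g.1 *m A *m invmx g.2) *m U'))
    (Q := weight (adj U' *m (g.2 *m Ad *m invmx g.1) *m U)^T) t :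
  GL2 g ->
  U *m adj U = 1%:M -> adj U *m U = 1%:M ->
  U' *m adj U' = 1%:M -> adj U' *m U' = 1%:M ->
  kappaT2 A Ad (expm (t%:C *: dconj U (adj U) (fun i => (w i)%:C)) *m g.1,
                expm (t%:C *: dconj U' (adj U') (fun j => (w' j)%:C)) *m g.2) ^+ 2 =
  (\sum_k P k * expR (t * (2 * (w k.1 - w' k.2)))) *
  (\sum_k Q k * expR (t * (2 * (w' k.2 - w k.1)))).
Proof.
move=> ug U1 U2 U'1 U'2.
rewrite (expm_scale_dconj _ _ U1 U2) (expm_scale_dconj _ _ U'1 U'2).
have sq q (V : 'M[C]_q) (v : 'I_q -> R) : adj V *m V = 1%:M ->
    adj (dconj V (adj V) (fun i => (expR (t * v i))%:C)) *m
      dconj V (adj V) (fun i => (expR (t * v i))%:C) =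
    dconj V (adj V) (fun i => (expR (2 * (t * v i)))%:C).
  move=> V2; rewrite adj_dconj (dconjM _ _ V2); congr dconj; apply/funext => i.
  by rewrite -rmorphM -expRD mulr2n mulrDl mul1r.
have unit q (V : 'M[C]_q) (v : 'I_q -> R) : V *m adj V = 1%:M -> adj V *m V = 1%:M ->
    dconj V (adj V) (fun i => (expR (t * v i))%:C) \in unitmx.
  by move=> V1 V2; apply: dconj_unit => // i; rewrite fmorph_eq0 gt_eqF ?expR_gt0.
have := @kappaT2_polar g (dconj U (adj U) (fun i => (expR (t * w i))%:C),
  dconj U' (adj U') (fun j => (expR (t * w' j))%:C)) U U'
  (fun i => t * w i) (fun j => t * w' j) ug (conj (unit _ _ _ U1 U2) (unit _ _ _ U'1 U'2))
  U1 U2 U'1 U'2 (sq _ _ _ U2) (sq _ _ _ U'2).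
move=> /= ->; congr (_ * _); apply: eq_bigr => k _; congr (_ * expR _); ring.
Qed.

Lemma kappaT2_weights (g : 'M[C]_m * 'M[C]_n) (U : 'M[C]_m) (U' : 'M[C]_n)
    (P := weight (adj U *m (g.1 *m A *m invmx g.2) *m U'))
    (Q := weight (adj U' *m (g.2 *m Ad *m invmx g.1) *m U)^T) :
  GL2 g -> 0 < kappaT2 A Ad g ->
  U *m adj U = 1%:M -> adj U *m U = 1%:M ->
  U' *m adj U' = 1%:M -> adj U' *m U' = 1%:M ->
  [/\ kappaT2 A Ad g ^+ 2 = (\sum_k P k) * (\sum_k Q k), 0 < \sum_k P k & 0 < \sum_k Q k].
Proof.
move=> ug kg U1 U2 U'1 U'2.
have e : kappaT2 A Ad g ^+ 2 = (\sum_k P k) * (\sum_k Q k).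
  have d0 q (V : 'M[C]_q) : V *m adj V = 1%:M ->
      adj (1%:M : 'M[C]_q) *m 1%:M = dconj V (adj V) (fun i => (expR (2 * (fun=> 0) i))%:C).
    move=> V1; rewrite adj1 mulmx1 -(dconj1 V1); congr dconj; apply/funext => i.
    by rewrite mulr0 expR0.
  have := @kappaT2_polar g (1%:M, 1%:M) U U' (fun=> 0) (fun=> 0) ug
    (conj (unitmx1 _ _) (unitmx1 _ _)) U1 U2 U'1 U'2 (d0 _ _ U1) (d0 _ _ U'1).
  rewrite /= !mul1mx -surjective_pairing => ->.
  by congr (_ * _); apply: eq_bigr => k _; rewrite subrr mulr0 expR0 mulr1.
have P0 : 0 <= \sum_k P k by apply: sumr_ge0 => k _; apply: weight_ge0.
have Q0 : 0 <= \sum_k Q k by apply: sumr_ge0 => k _; apply: weight_ge0.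
have : 0 < (\sum_k P k) * (\sum_k Q k) by rewrite -e exprn_gt0.
move: (\sum_k P k) (\sum_k Q k) P0 Q0 e => p q p0 q0 e pq; split=> //; nra.
Qed.

Lemma ln_half_sqr (x : R) : 0 < x -> ln x = 2^-1 * ln (x ^+ 2).
Proof. by move=> x0; rewrite lnXn //; field. Qed.

Variable G : set ('M[C]_m * 'M[C]_n).

(** By uniqueness of derivatives, the pairing is the derivative of half a sum of two log-sum-exp
    functions; the half cancels the 2 in the exponents. *)
Lemma gradient_pairing (g D : 'M[C]_m * 'M[C]_n) (U : 'M[C]_m) (U' : 'M[C]_n)
    (w : 'I_m -> R) (w' : 'I_n -> R)
    (W := (dconj U (adj U) (fun i => (w i)%:C), dconj U' (adj U') (fun j => (w' j)%:C)))
    (P := weight (adj U *m (g.1 *m A *m invmx g.2) *m U'))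
    (Q := weight (adj U' *m (g.2 *m Ad *m invmx g.1) *m U)^T) :
  (forall h, GL2 h -> 0 < kappaT2 A Ad h) ->
  is_grad2 G (fun g => ln (kappaT2 A Ad g)) g D -> iLieK2 G W ->
  GL2 g ->
  U *m adj U = 1%:M -> adj U *m U = 1%:M ->
  U' *m adj U' = 1%:M -> adj U' *m U' = 1%:M ->
  inner2 D W = (\sum_k P k * (w k.1 - w' k.2)) / (\sum_k P k) +
               (\sum_k Q k * (w' k.2 - w k.1)) / (\sum_k Q k).
Proof.
move=> kpos [_ gradD] LW ug U1 U2 U'1 U'2.
have [_ P0 Q0] := kappaT2_weights ug (kpos _ ug) U1 U2 U'1 U'2.
have dF := gradD _ LW.
have unit q (V : 'M[C]_q) (v : 'I_q -> R) t : V *m adj V = 1%:M -> adj V *m V = 1%:M ->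
    expm (t%:C *: dconj V (adj V) (fun i => (v i)%:C)) \in unitmx.
  move=> V1 V2; rewrite (expm_scale_dconj _ _ V1 V2).
  by apply: dconj_unit => // i; rewrite fmorph_eq0 gt_eqF ?expR_gt0.
have sum_pos (S a : 'I_m * 'I_n -> R) : (forall k, 0 <= S k) -> 0 < \sum_k S k ->
    0 < \sum_k S k * expR (a k).
  move=> S0 Spos; rewrite lt_neqAle sumr_ge0 ?andbT; last first.
    by move=> k _; rewrite mulr_ge0 ?expR_ge0.
  rewrite eq_sym psumr_neq0; last by move=> k _; rewrite mulr_ge0 ?expR_ge0.
  move: (gt_eqF Spos) => /negbT; rewrite psumr_neq0 // => /hasP[k kI /= Sk].
  by apply/hasP; exists k => //=; rewrite mulr_gt0 ?expR_gt0.
have eF : (fun t : R => ln (kappaT2 A Ad (expm (t%:C *: W.1) *m g.1, expm (t%:C *: W.2) *m g.2))) =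
    2^-1 \*: ((fun t => ln (\sum_k P k * expR (t * (2 * (w k.1 - w' k.2))))) +
              (fun t => ln (\sum_k Q k * expR (t * (2 * (w' k.2 - w k.1)))))).
  apply/funext => t; rewrite ln_half_sqr; last first.
    by case: ug => ug1 ug2; apply: kpos; split; rewrite unitmx_mul /= unit.
  rewrite kappaT2_geodesic // lnM // posrE; apply: sum_pos => // k; exact: weight_ge0.
rewrite eF in dF.
have dP := is_derive_ln_sum_expR (fun k => 2 * (w k.1 - w' k.2)) P0.
have dQ := is_derive_ln_sum_expR (fun k => 2 * (w' k.2 - w k.1)) Q0.
have dPQ := is_deriveZ 2^-1 (is_deriveD dP dQ).
have <- := @derive_val _ _ _ _ _ _ _ dF; rewrite (@derive_val _ _ _ _ _ _ _ dPQ).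
have two (S a : 'I_m * 'I_n -> R) : \sum_k S k * (2 * a k) = 2 * \sum_k S k * a k.
  by rewrite mulr_sumr; apply: eq_bigr => k _; rewrite mulrCA.
rewrite !two /GRing.scale /=. by field; rewrite !gt_eqF.
Qed.

End KempfNess.

(** * Decrease along a step, and near optimality from a small gradient *)

Lemma sqr_sub_le_sqr (R : realDomainType) (u c N : R) :
  0 <= u -> 0 <= c -> u <= N -> c <= N -> (u - c) ^+ 2 <= N ^+ 2.
Proof. by move=> u0 c0 uN cN; nra. Qed.

Lemma le8_of_le_double_sqrt (R : realFieldType) (nu M : R) :
  0 <= M -> M ^+ 2 = 2 * nu -> nu <= M + M -> nu <= 8.
Proof. by move=> M0 M2 nuM; nra. Qed.

Lemma descent_arithmetic (R : realFieldType) (lP lQ LP LQ sp sq nu : R) :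
  LP <= - (sp / 4) + 3 / 32 * nu -> LQ <= - (sq / 4) + 3 / 32 * nu -> nu = sp + sq ->
  2^-1 * (lP + LP + (lQ + LQ)) <= 2^-1 * (lP + lQ) - nu / 32.
Proof. by move=> h1 h2 e; lra. Qed.

Section GradientDescent.
Local Open Scope complex_scope.
Local Open Scope classical_set_scope.
Variables (R : realType) (m n : nat).
Local Notation C := (complex R).
Variables (A : 'M[C]_(m, n)) (Ad : 'M[C]_(n, m)) (G : set ('M[C]_m * 'M[C]_n)).

Lemma inner2_dconj (U : 'M[C]_m) (U' : 'M[C]_n) (w : 'I_m -> R) (w' : 'I_n -> R)
    (W := (dconj U (adj U) (fun i => (w i)%:C), dconj U' (adj U') (fun j => (w' j)%:C))) :
  adj U *m U = 1%:M -> adj U' *m U' = 1%:M ->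
  inner2 W W = \sum_i w i ^+ 2 + \sum_j w' j ^+ 2.
Proof. by move=> U2 U'2; rewrite /inner2 !cinner_self !frob_sqr_dconj. Qed.

Lemma sqr_difference_le (w : 'I_m -> R) (w' : 'I_n -> R) i j :
  (w i - w' j) ^+ 2 <= 2 * (\sum_i w i ^+ 2 + \sum_j w' j ^+ 2).
Proof.
have h q (v : 'I_q -> R) k : v k ^+ 2 <= \sum_k v k ^+ 2.
  by rewrite (bigD1 k) //= lerDl; apply: sumr_ge0 => l _; apply: sqr_ge0.
have := h _ w i; have := h _ w' j; have := sqr_ge0 (w i + w' j); nra.
Qed.

(** Adding the two log-mean bounds and halving gives [(- nu / 4 + 3 nu / 16) / 2 = - nu / 32]. *)
Lemma gradient_step_decrease (g D : 'M[C]_m * 'M[C]_n) (e := (- 8^-1 : R)%:C) :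
  (forall h, GL2 h -> 0 < kappaT2 A Ad h) -> GL2 g ->
  is_grad2 G (fun g => ln (kappaT2 A Ad g)) g D ->
  ln (kappaT2 A Ad (expm (e *: D.1) *m g.1, expm (e *: D.2) *m g.2)) <=
  ln (kappaT2 A Ad g) - inner2 D D / 32.
Proof.
move=> kpos ug gradD; have [LD _] := gradD; have [_ [hD1 hD2]] := LD.
have [U [w [U1 U2 eD1]]] := hermitian_diagonalization hD1.
have [U' [w' [U'1 U'2 eD2]]] := hermitian_diagonalization hD2.
have eD : D = (dconj U (adj U) (fun i => (w i)%:C), dconj U' (adj U') (fun j => (w' j)%:C)).
  by rewrite -eD1 -eD2; case: (D).
have [k2 P0 Q0] := kappaT2_weights ug (kpos _ ug) U1 U2 U'1 U'2.
have LW := LD; rewrite eD in LW.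
have pair := gradient_pairing kpos gradD LW ug U1 U2 U'1 U'2.
rewrite -eD in pair.
have nuE := inner2_dconj w w' U2 U'2; rewrite -eD in nuE.
have step := kappaT2_geodesic A Ad w w' (- 8^-1) ug U1 U2 U'1 U'2.
rewrite -eD1 -eD2 in step.
move: k2 P0 Q0 pair step.
have : forall k, 0 <= weight (adj U *m (g.1 *m A *m invmx g.2) *m U') k by exact: weight_ge0.
have : forall k, 0 <= weight (adj U' *m (g.2 *m Ad *m invmx g.1) *m U)^T k by exact: weight_ge0.
set P := weight (adj U *m _ *m _); set Q := weight (_ ^T) => Qge Pge k2 P0 Q0 pair step.
set nu := inner2 D D in nuE pair *.
pose a (k : 'I_m * 'I_n) := w k.1 - w' k.2.
pose b (k : 'I_m * 'I_n) := w' k.2 - w k.1.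
pose p k := P k / \sum_k P k; pose q k := Q k / \sum_k Q k.
have p0 k : 0 <= p k by rewrite divr_ge0 // ltW.
have q0 k : 0 <= q k by rewrite divr_ge0 // ltW.
have p1 : \sum_k p k = 1 by rewrite -mulr_suml divff // gt_eqF.
have q1 : \sum_k q k = 1 by rewrite -mulr_suml divff // gt_eqF.
have a2 k : a k ^+ 2 <= 2 * nu by rewrite nuE; apply: sqr_difference_le.
have b2 k : b k ^+ 2 <= 2 * nu by rewrite /b -opprB sqrrN; apply: a2.
have pairE : nu = \sum_k p k * a k + \sum_k q k * b k.
  by rewrite {1}pair !mulr_suml; congr (_ + _); apply: eq_bigr => k _; rewrite /p /q /a /b /= mulrAC.
have nu0 : 0 <= nu.
  by rewrite nuE addr_ge0 // sumr_ge0 // => i _; apply: sqr_ge0.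
(* [nu] is a sum of two weighted means of numbers at most [sqrt (2 nu)], so
   [nu <= 2 sqrt (2 nu)]. *)
have nu8 : nu <= 8.
  have M2 : Num.sqrt (2 * nu) ^+ 2 = 2 * nu by rewrite sqr_sqrtr // mulr_ge0.
  have mean_le (r c : 'I_m * 'I_n -> R) : (forall k, 0 <= r k) -> \sum_k r k = 1 ->
      (forall k, c k ^+ 2 <= 2 * nu) -> \sum_k r k * c k <= Num.sqrt (2 * nu).
    move=> r0 r1 c2; rewrite -[leRHS]mul1r -[X in _ <= X * _]r1 mulr_suml; apply: ler_sum => j _.
    apply: ler_wpM2l => //; apply: le_trans (ler_norm _) _.
    by rewrite -sqrtr_sqr ler_wsqrtr.
  apply: (le8_of_le_double_sqrt (sqrtr_ge0 (2 * nu)) M2).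
  by rewrite {1}pairE lerD // mean_le.
have exp_sum (S c : 'I_m * 'I_n -> R) : 0 < \sum_k S k ->
    \sum_k S k * expR (- 8^-1 * (2 * c k)) =
    (\sum_k S k) * \sum_k (S k / \sum_k S k) * expR (- (c k / 4)).
  move=> S0; rewrite mulr_sumr; apply: eq_bigr => k _.
  rewrite mulrA [(\sum_k S k) * _]mulrC divfK ?gt_eqF //.
  by congr (_ * expR _); field.
have expS_pos (r c : 'I_m * 'I_n -> R) : (forall k, 0 <= r k) -> \sum_k r k = 1 ->
    0 < \sum_k r k * expR (c k).
  move=> r0 r1; have := weighted_AMGM c r0 r1 ltr01.
  by apply: lt_le_trans; rewrite mul1r expR_gt0.
have lp := ln_mean_exp_le (P := predT) p0 p1 a2 nu8.
have lq := ln_mean_exp_le (P := predT) q0 q1 b2 nu8.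
rewrite (exp_sum P a P0) (exp_sum Q b Q0) in step.
have kg := kpos _ ug.
move: step; set g' := (_ *m _, _ *m _); move: (g') => {}g' step.
have kg' : 0 < kappaT2 A Ad g'.
  rewrite lt_neqAle mulr_ge0 ?frob_ge0 // andbT eq_sym -sqrf_eq0 step.
  by rewrite !mulf_neq0 // gt_eqF // expS_pos.
have ep := expS_pos p (fun k => - (a k / 4)) p0 p1.
have eq := expS_pos q (fun k => - (b k / 4)) q0 q1.
have ln_step (K K' : R) : 0 < K -> 0 < K' -> K ^+ 2 = (\sum_k P k) * (\sum_k Q k) ->
    K' ^+ 2 = ((\sum_k P k) * \sum_k p k * expR (- (a k / 4))) *
              ((\sum_k Q k) * \sum_k q k * expR (- (b k / 4))) ->
    ln K' <= ln K - nu / 32.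
  move=> K0 K'0 eK eK'; rewrite (ln_half_sqr K'0) (ln_half_sqr K0) eK eK'.
  rewrite !lnM ?posrE ?mulr_gt0 //; exact: descent_arithmetic lp lq pairE.
exact: ln_step kg kg' k2 step.
Qed.

Lemma polar_diagonalization q (X : 'M[C]_q) : X \in unitmx ->
  exists U (x : 'I_q -> R), [/\ U *m adj U = 1%:M, adj U *m U = 1%:M &
    adj X *m X = dconj U (adj U) (fun i => (expR (2 * x i))%:C)].
Proof.
move=> uX; have hX : Defs.hermitian (adj X *m X) by rewrite /Defs.hermitian adjM adjK.
have [U [w [U1 U2 eX]]] := hermitian_diagonalization hX.
have [uU uaU] := mulmx1_unit U1.
have eD : adj (X *m U) *m (X *m U) = diag_mx (\row_i (w i)%:C).
  rewrite adjM !mulmxA -(mulmxA (adj U)) eX /dconj !mulmxA U2 mul1mx.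
  by rewrite -mulmxA U2 mulmx1.
have uD : diag_mx (\row_i (w i)%:C) \in unitmx.
  by rewrite -eD unitmx_mul adj_unit unitmx_mul uX uU.
have w0 i : 0 < w i.
  rewrite lt_neqAle; apply/andP; split.
    move: uD; rewrite unitmxE det_diag unitfE => /prodf_neq0/(_ i isT).
    by rewrite mxE fmorph_eq0 eq_sym.
  have /matrixP/(_ i i) := eD; rewrite !mxE eqxx mulr1n => eW.
  rewrite -ler0c -eW; apply: sumr_ge0 => k _; rewrite adjE mulrC.
  exact: mulcJ_ge0.
exists U, (fun i => 2^-1 * ln (w i)); split; [exact: U1|exact: U2|].
rewrite eX; congr dconj.
by apply/funext => i; rewrite mulrA divff ?pnatr_eq0 // mul1r lnK // posrE.
Qed.

Lemma dconj_eq1 q (U : 'M[C]_q) x i : adj U *m U = 1%:M ->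
  dconj U (adj U) x = 1%:M -> x i = 1.
Proof.
move=> U2 /(congr1 (fun M => (adj U *m M *m U) i i)).
rewrite mulmx1 U2 /dconj !mulmxA U2 mul1mx -mulmxA U2 mulmx1 !mxE eqxx.
by rewrite mulr1n.
Qed.

Hypotheses (symG : symmetric2 G) (torusG : torus_dichotomy G).
Hypotheses (m_gt0 : (0 < m)%N) (n_gt0 : (0 < n)%N).

Lemma gradient_gap (g D h : 'M[C]_m * 'M[C]_n)
    (delta := 2^-1 * Num.sqrt ((m + n)%:R ^+ 3 * inner2 D D)) :
  (forall h, GL2 h -> 0 < kappaT2 A Ad h) -> G g -> G h ->
  is_grad2 G (fun g => ln (kappaT2 A Ad g)) g D -> delta < 1 ->
  kappaT2 A Ad g * (1 - delta) <= kappaT2 A Ad (h.1 *m g.1, h.2 *m g.2).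
Proof.
move=> kpos Gg Gh gradD delta1; have [[GGL _ _ _] _ _] := symG.
have ug := GGL _ Gg; have uh := GGL _ Gh.
have [U [x [U1 U2 hx]]] := polar_diagonalization uh.1.
have [U' [y [U'1 U'2 hy]]] := polar_diagonalization uh.2.
have [k2 P0 Q0] := kappaT2_weights ug (kpos _ ug) U1 U2 U'1 U'2.
have polar := kappaT2_polar A Ad ug uh U1 U2 U'1 U'2 hx hy.
have pair f f' L := @gradient_pairing _ _ _ A Ad G g D U U' (fun i => f (x i))
  (fun j => f' (y j)) kpos gradD L ug U1 U2 U'1 U'2.
move: k2 P0 Q0 polar pair.
have : forall k, 0 <= weight (adj U *m (g.1 *m A *m invmx g.2) *m U') k by exact: weight_ge0.
have : forall k, 0 <= weight (adj U' *m (g.2 *m Ad *m invmx g.1) *m U)^T k by exact: weight_ge0.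
set P := weight (adj U *m _ *m _); set Q := weight (_ ^T) => Qge Pge k2 P0 Q0 polar pair.
(* the vertices are the eigenvalues, represented by the first index at which they occur *)
pose rep q (i0 : 'I_q) (z : 'I_q -> R) r := odflt i0 [pick i | z i == r].
have repE q (i0 : 'I_q) z i : z (rep q i0 z (z i)) = z i.
  by rewrite /rep; case: pickP => [j /eqP //|/(_ i)]; rewrite eqxx.
pose rx := rep m (Ordinal m_gt0) x; pose ry := rep n (Ordinal n_gt0) y.
pose V := ('I_m + 'I_n)%type; pose E := (('I_m * 'I_n) * bool)%type.
pose vx r : V := inl (rx r); pose vy r : V := inr (ry r).
pose tgt (e : E) : V := if e.2 then vx (x e.1.1) else vy (y e.1.2).
pose src (e : E) : V := if e.2 then vy (y e.1.2) else vx (x e.1.1).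
pose side (v : V) := if v is inl _ then true else false.
pose a (e : E) : R := if e.2 then P e.1 / \sum_k P k else Q e.1 / \sum_k Q k.
have sumE (F : E -> R) : \sum_e F e = \sum_k F (k, true) + \sum_k F (k, false).
  rewrite -big_split /=; transitivity (\sum_k \sum_b F (k, b)).
    by rewrite pair_bigA; apply: eq_bigr => -[].
  by apply: eq_bigr => k _; rewrite big_bool.
have sumT (F : E -> R) : \sum_(e | side (tgt e)) F e = \sum_k F (k, true).
  by rewrite big_mkcond sumE /= [X in _ + X]big1 ?addr0.
have sumF (F : E -> R) : \sum_(e | ~~ side (tgt e)) F e = \sum_k F (k, false).
  by rewrite big_mkcond sumE /= [X in X + _]big1 ?add0r.
have a0 e : 0 <= a e by rewrite /a; case: e.2; rewrite divr_ge0 // ltW.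
have bip e : side (src e) = ~~ side (tgt e) by rewrite /src /tgt; case: e.2.
have a1 : \sum_(e | side (tgt e)) a e = 1.
  by rewrite sumT /a /= -mulr_suml divff // gt_eqF.
have a2 : \sum_(e | ~~ side (tgt e)) a e = 1.
  by rewrite sumF /a /= -mulr_suml divff // gt_eqF.
have [l [lV cap]] := bipartite_capacity_bound a0 bip a1 a2.
have lN v : (l v < m + n)%N by have := lV v; rewrite card_sum !card_ord.
(* A common shift leaves level differences unchanged. Without the full torus every [y j] is 0, and
   shifting by the level of that vertex makes [f'] vanish there, as the trivial second factor
   requires. *)
pose c0 := if `[< torus_in2 G >] then 0%N else l (vy 0).
have c0N : (c0 < m + n)%N.
  by rewrite /c0; case: ifP => _ //; rewrite addn_gt0 m_gt0.
(* Levels are read at the representative of an eigenvalue, so the direction is a function of the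
   spectrum, as [spectral_direction] requires. *)
pose f r : R := (l (vx r))%:R - c0%:R.
pose f' r : R := (l (vy r))%:R - c0%:R.
have LW := @spectral_direction _ _ _ G symG torusG h U U' x y f f' Gh U1 U2 U'1 U'2 hx hy.
have {}LW : iLieK2 G (dconj U (adj U) (fun i => (f (x i))%:C),
            dconj U' (adj U') (fun j => (f' (y j))%:C)).
  apply: LW; case: torusG => [|[_ Gtriv]]; first by left.
  have [tG|ntG] := pselect (torus_in2 G); first by left.
  right; have y0 j : y j = 0.
    have := dconj_eq1 j U'2; rewrite (Gtriv _ Gh) adj1 mulmx1 in hy.
    move=> /(_ _ (esym hy)) [] /eqP; rewrite -[X in _ == X]expR0 (inj_eq (@expR_inj R)).
    by rewrite mulf_eq0 pnatr_eq0 /= => /eqP.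
  split=> // j; rewrite y0 /f' /c0; case: asboolP => // _; exact: subrr.
have normW := inner2_dconj (fun i => f (x i)) (fun j => f' (y j)) U2 U'2.
have CS := inner2_cauchy_schwarz D (dconj U (adj U) (fun i => (f (x i))%:C),
            dconj U' (adj U') (fun j => (f' (y j))%:C)).
have slope := pair f f' LW.
move: (LW) normW CS slope; set W := (_, _) => _ normW CS slope.
(* Each of the [m + n] eigenvalues of [W] is a difference of two naturals below [m + n]. *)
have boundW : inner2 W W <= (m + n)%:R ^+ 3.
  have sq (u : nat) : (u < m + n)%N -> (u%:R - c0%:R) ^+ 2 <= (m + n)%:R ^+ 2 :> R.
    move=> uN; apply: sqr_sub_le_sqr; [exact: ler0n|exact: ler0n| |].
      by rewrite ler_nat; apply: ltnW.
    by rewrite ler_nat; apply: ltnW.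
  rewrite normW; apply: (@le_trans _ _ (\sum_(i < m) (m + n)%:R ^+ 2 + \sum_(j < n) (m + n)%:R ^+ 2)).
    by apply: lerD; apply: ler_sum => i _; apply: sq.
  by rewrite !sumr_const !card_ord -mulrnDr [leRHS]exprSr mulr_natr.
have slope_le : inner2 D W <= Num.sqrt ((m + n)%:R ^+ 3 * inner2 D D).
  apply: le_trans (ler_norm _) _; rewrite -sqrtr_sqr ler_wsqrtr // mulrC.
  apply: le_trans CS _; apply: ler_wpM2l => //.
  by rewrite /inner2 !cinner_self addr_ge0 ?sqr_ge0.
have slopeE : \sum_e a e * ((l (tgt e))%:R - (l (src e))%:R) = inner2 D W.
  rewrite slope sumE !mulr_suml; congr (_ + _); apply: eq_bigr => k _;
    rewrite /a /tgt /src /f /f' /=; ring.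
set s := 1 - _ in cap; have s_delta : 1 - delta <= s.
  by rewrite /s slopeE /delta lerD2l lerN2 ler_wpM2l ?invr_ge0.
have s0 : 0 <= s by apply: le_trans s_delta; rewrite subr_ge0 ltW.
pose z (v : V) := match v with inl i => 2 * x i | inr j => 2 * y j end.
have ex i : x (rx (x i)) = x i by apply: repE.
have ey j : y (ry (y j)) = y j by apply: repE.
have := cap s0 z; rewrite sumT sumF /a /tgt /src /=.
under eq_bigr do rewrite ex ey.
under [X in _ * X]eq_bigr do rewrite ex ey.
have normalize (S c : 'I_m * 'I_n -> R) : \sum_k S k / (\sum_k S k) * expR (c k) =
    (\sum_k S k * expR (c k)) / \sum_k S k.
  by rewrite mulr_suml; apply: eq_bigr => k _; rewrite mulrAC.
rewrite !normalize.
under eq_bigr do rewrite -mulrBr.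
under [X in _ * (X / _)]eq_bigr do rewrite -mulrBr.
rewrite mulrACA -invfM -k2 -polar => cap2.
have kg := kpos _ ug.
have unsquare (K K' : R) : 0 < K -> 0 <= K' -> s ^+ 2 <= K' ^+ 2 / K ^+ 2 ->
    K * (1 - delta) <= K'.
  move=> K0 K'0; rewrite ler_pdivlMr ?exprn_gt0 // -exprMn ler_sqr ?nnegrE ?mulr_ge0 ?(ltW K0) //.
  by rewrite mulrC; apply: le_trans; rewrite ler_pM2l.
by apply: unsquare kg _ cap2; rewrite mulr_ge0 ?frob_ge0.
Qed.

End GradientDescent.

(** * Telescoping and convergence *)

Lemma no_small_gradient (R : realFieldType) (eps a b c d : R) :
  eps <= a - c -> a <= b -> b + d <= c -> - eps < d -> False.
Proof. lra. Qed.

Lemma telescoping_step (R : realFieldType) (a b a0 k u nu : R) :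
  b <= a - nu / 32 -> a <= a0 - k * (u / 32) -> u <= nu -> b <= a0 - (k + 1) * (u / 32).
Proof. lra. Qed.

Lemma gap_ge0 (R : realFieldType) (eps a b c : R) :
  0 < eps -> eps <= a - c -> a <= b -> 0 <= b - c.
Proof. lra. Qed.

Lemma no_late_gap (R : realFieldType) (eps a b c x : R) :
  0 < eps -> eps <= a - c -> a <= b - x -> b - c <= x -> False.
Proof. lra. Qed.

Section Convergence.
Local Open Scope complex_scope.
Local Open Scope classical_set_scope.
Variables (R : realType) (m n : nat).
Local Notation C := (complex R).

(** By contradiction: a gap of at least [eps] at time [T] was there at all earlier times, which
    keeps every squared gradient norm at least [eps^2 / (m + n)^3], and the total decrease uses up
    the initial gap. The constant is [256 = 32 * 8], from the decrease [nu / 32] and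
    [(m + n)^3 <= 8 max (m^3, n^3)]. *)
Lemma gradient_descent_convergence (G : set ('M[C]_m * 'M[C]_n))
    (A : 'M[C]_(m, n)) (Ad : 'M[C]_(n, m)) (gs Hs : nat -> 'M[C]_m * 'M[C]_n)
    (K := inf [set kappaT2 A Ad g | g in G]) (eps : R) (T : nat) :
  (0 < m)%N -> (0 < n)%N -> symmetric2 G -> torus_dichotomy G ->
  A != 0 -> is_pinv A Ad -> gs 0%N = (1%:M, 1%:M) ->
  (forall k, is_grad2 G (fun g => ln (kappaT2 A Ad g)) (gs k) (Hs k)) ->
  (forall k, gs k.+1 = (expm ((- 8^-1 : R)%:C *: (Hs k).1) *m (gs k).1,
                        expm ((- 8^-1 : R)%:C *: (Hs k).2) *m (gs k).2)) ->
  0 < eps < 2^-1 ->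
  256 * (maxn (m ^ 3) (n ^ 3))%:R * ln (kappaF A Ad / K) / eps ^+ 2 <= T%:R ->
  ln (kappaT2 A Ad (gs T)) - ln K < eps.
Proof.
move=> m0 n0 symG torusG A0 pinv gs0 grad gsS /andP[eps0 eps2] hT.
have [[GGL G1 GM GV] _ _] := symG.
have [k0 k0pos k0le] := kappaT2_lower_bound pinv A0.
have kpos h : GL2 h -> 0 < kappaT2 A Ad h by move=> /k0le; apply: lt_le_trans.
have Ggs k : G (gs k).
  elim: k => [|k IH]; first by rewrite gs0.
  rewrite gsS; have [[LH _] _] := grad k.
  exact: GM _ _ (LH (- 8^-1)) IH.
have S0 : [set kappaT2 A Ad g | g in G] !=set0 by exists (kappaT2 A Ad (1%:M, 1%:M)), (1%:M, 1%:M).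
have lbK c : (forall g, G g -> c <= kappaT2 A Ad g) -> c <= K.
  by move=> lb; apply: lb_le_inf => // _ [g Gg <-]; apply: lb.
have Kle g : G g -> K <= kappaT2 A Ad g.
  move=> Gg; apply: ge_inf; last by exists g.
  by exists 0 => _ [h Gh <-]; rewrite ltW // kpos //; apply: GGL.
have Kpos : 0 < K by apply: lt_le_trans k0pos _; apply: lbK => g /GGL; apply: k0le.
pose F k := ln (kappaT2 A Ad (gs k)).
pose nu k := inner2 (Hs k) (Hs k).
have nu0 k : 0 <= nu k by rewrite /nu /inner2 !cinner_self addr_ge0 ?sqr_ge0.
have step k : F k.+1 <= F k - nu k / 32.
  by rewrite /F gsS; apply: gradient_step_decrease kpos (GGL _ (Ggs k)) (grad k).
rewrite ltNge; apply/negP => epsF.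
have mono k : (k <= T)%N -> F T <= F k.
  elim: T {hT epsF} => [|T IH]; first by rewrite leqn0 => /eqP->.
  rewrite leq_eqVlt => /predU1P[->//|kT]; apply: le_trans (IH kT).
  by apply: le_trans (step T) _; rewrite gerBl divr_ge0.
set N : R := (m + n)%:R.
have Npos : 0 < N by rewrite /N ltr0n addn_gt0 m0.
have large k : (k <= T)%N -> eps ^+ 2 / N ^+ 3 <= nu k.
  move=> kT; rewrite leNgt; apply/negP => small.
  pose delta := 2^-1 * Num.sqrt (N ^+ 3 * nu k).
  have dhalf : delta < eps / 2.
    have : Num.sqrt (N ^+ 3 * nu k) < eps.
      rewrite -[ltRHS]gtr0_norm // -sqrtr_sqr ltr_sqrt ?exprn_gt0 // mulrC.
      by rewrite -ltr_pdivlMr ?exprn_gt0.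
    rewrite /delta; lra.
  have d1 : delta < 1 by lra.
  have Kge : kappaT2 A Ad (gs k) * (1 - delta) <= K.
    apply: lbK => g Gg; have [ug1 ug2] := GGL _ (Ggs k).
    (* Every [g] in [G] is [(g g_k^-1) g_k], so the gap bound at [g_k] reaches all competitors. *)
    have Gq := GM _ _ Gg (GV _ (Ggs k)).
    have := gradient_gap symG torusG m0 n0 kpos (Ggs k) Gq (grad k) d1.
    rewrite /= !mulmxKV //; by case: (g).
  have dpos : 0 < 1 - delta by rewrite subr_gt0.
  have kg := kpos _ (GGL _ (Ggs k)).
  have lnle : F k + ln (1 - delta) <= ln K.
    by rewrite -lnM ?posrE // ler_ln ?posrE // mulr_gt0.
  (* For [0 < eps < 1] one has [(1 - eps / 2) (1 + eps) > 1], and [1 + eps <= exp eps]. *)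
  have lnd : - eps < ln (1 - delta).
    rewrite -(expRK (- eps)) ltr_ln ?posrE ?expR_gt0 // expRN.
    have e1 := expR_ge1Dx eps; have e0 := expR_gt0 eps.
    rewrite -[ltLHS]mul1r ltr_pdivrMr //.
    apply: (@lt_le_trans _ _ ((1 - delta) * (1 + eps))); last by rewrite ler_pM2l.
    by move: dhalf eps0 eps2; clear; nra.
  exact: no_small_gradient epsF (mono k kT) lnle lnd.
have tele k : (k <= T)%N -> F k <= F 0%N - k%:R * (eps ^+ 2 / N ^+ 3 / 32).
  elim: k => [|k IH] kT; first by rewrite mul0r subr0.
  rewrite -(natr1 k).
  exact: telescoping_step (step k) (IH (ltnW kT)) (large k (ltnW kT)).
have kF : kappaT2 A Ad (gs 0%N) = kappaF A Ad.
  by rewrite gs0 /kappaT2 /kappaF /= !invmx1 !mul1mx !mulmx1.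
have L_eq : ln (kappaF A Ad / K) = F 0%N - ln K.
  by rewrite ln_div ?posrE // -kF //; apply/kpos/GGL.
rewrite L_eq in hT.
have N3 : N ^+ 3 <= 8 * (maxn (m ^ 3) (n ^ 3))%:R.
  rewrite -natrX -natrM ler_nat -[X in (_ <= X * _)%N]/(2 ^ 3)%N.
  have [mn|nm] := leqP m n.
    apply: (@leq_trans ((2 * n) ^ 3)%N).
      by rewrite leq_exp2r // mul2n -addnn leq_add2r.
    by rewrite expnMn leq_mul2l leq_maxr orbT.
  apply: (@leq_trans ((2 * m) ^ 3)%N).
    by rewrite leq_exp2r // mul2n -addnn leq_add2l ltnW.
  by rewrite expnMn leq_mul2l leq_maxl orbT.
set M := (maxn _ _)%:R in hT N3.
have eps2pos : 0 < eps ^+ 2 by rewrite exprn_gt0.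
have N3pos : 0 < N ^+ 3 by rewrite exprn_gt0.
have L0 : 0 <= F 0%N - ln K by exact: gap_ge0 eps0 epsF (mono 0%N (leq0n T)).
have gapT : F 0%N - ln K <= T%:R * (eps ^+ 2 / N ^+ 3 / 32).
  apply: le_trans (ler_wpM2r _ hT); last by rewrite !divr_ge0 // ltW.
  have -> : 256 * M * (F 0%N - ln K) / eps ^+ 2 * (eps ^+ 2 / N ^+ 3 / 32) =
      (F 0%N - ln K) * (8 * M / N ^+ 3).
    by move: (gt_eqF eps0) (gt_eqF Npos); clearbody N M; move=> e1 e2; field; rewrite e1 e2.
  by rewrite ler_peMr // ler_pdivlMr // mul1r.
exact: no_late_gap eps0 epsF (tele T (leqnn T)) gapT.
Qed.

End Convergence.

(** * Groups acting on the left only, through a trivial second factor *)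

Section SingleGroup.
Local Open Scope complex_scope.
Local Open Scope classical_set_scope.
Variables (R : realType) (m n : nat).
Local Notation C := (complex R).
Variable G : set 'M[C]_m.

Definition with_trivial_factor : set ('M[C]_m * 'M[C]_n) :=
  [set g | G g.1 /\ g.2 = 1%:M].

Lemma polyfun_fst (p : 'M[C]_m -> C) : polyfun (@coords1 R m) p ->
  polyfun (@pair_coords R m n) (fun g => p g.1).
Proof.
elim=> [c|f [i [j ->]]|f h _ IHf _ IHh|f h _ IHf _ IHh].
- exact: pf_const.
- by apply: pf_coord; left; exists i, j.
- exact: pf_add IHf IHh.
- exact: pf_mul IHf IHh.
Qed.

Lemma symmetric2_with_trivial_factor : symmetric1 G -> symmetric2 with_trivial_factor.
Proof.
move=> [[GGL G1 GM GV] [S [Spoly SG]] Gadj]; split; first split.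
- by move=> [X Y] [/= /GGL uX ->]; split => //; exact: unitmx1.
- by split.
- by move=> [X Y] [X' Y'] [/= GX ->] [/= GX' ->]; split; [exact: GM|exact: mulmx1].
- by move=> [X Y] [/= GX ->]; split; [exact: GV|exact: invmx1].
(* The equations are those of [G] on the first factor and equality with the identity on the second,
   written as a sum because [polyfun] has no subtraction. *)
- exists [set p | (exists2 q, S q & p = fun g : 'M[C]_m * 'M[C]_n => q g.1) \/
    exists i j, p = fun g : 'M[C]_m * 'M[C]_n => g.2 i j + (- (1%:M : 'M[C]_n) i j)]; split.
    move=> _ [[q Sq ->]|[i [j ->]]]; first exact/polyfun_fst/Spoly.
    by apply: pf_add; [apply: pf_coord; right; exists i, j|exact: pf_const].
  move=> [X Y]; split=> [[/= GX ->]|[[/= uX _] van]].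
    split; first by split; [exact: GGL|exact: unitmx1].
    move=> _ [[q Sq ->]|[i [j ->]]] /=; last exact: subrr.
    by have /SG[_] := GX; apply.
  split=> /=; first by apply/SG; split=> // q Sq; apply: (van (fun g : 'M[C]_m * 'M[C]_n => q g.1)); left; exists q.
  apply/matrixP => i j; apply/eqP; rewrite -subr_eq0; apply/eqP.
  by apply: (van (fun g : 'M[C]_m * 'M[C]_n => g.2 i j + (- (1%:M : 'M[C]_n) i j))); right; exists i, j.
- by move=> [X Y] [/= GX ->]; split; [exact: Gadj|exact: adj1].
Qed.

Lemma torus_with_trivial_factor : torus_in1 G -> torus_dichotomy with_trivial_factor.
Proof. by move=> tG; right; split=> [X dX uX|g []//]; split=> //; apply: tG. Qed.

Lemma expm_scale0 t : expm (t%:C *: (0 : 'M[C]_n)) = 1%:M.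
Proof.
have e0 : (0 : 'M[C]_n) = dconj 1%:M (adj 1%:M) (fun i => ((fun=> 0) i)%:C).
  by apply/matrixP => i j; rewrite dconjE mxE big1 // => k _; rewrite mulr0 mul0r.
have I1 : (1%:M : 'M[C]_n) *m adj 1%:M = 1%:M by rewrite adj1 mulmx1.
have I2 : adj (1%:M : 'M[C]_n) *m 1%:M = 1%:M by rewrite adj1 mulmx1.
rewrite e0 (expm_scale_dconj _ _ I1 I2) -[RHS](dconj1 I1).
by congr dconj; apply/funext => i; rewrite mulr0 expR0.
Qed.

Variables (A : 'M[C]_(m, n)) (Ad : 'M[C]_(n, m)).

Lemma kappaT2_trivial_factor X : kappaT2 A Ad (X, 1%:M) = kappaT1 A Ad X.
Proof. by rewrite /kappaT2 /kappaT1 /= invmx1 mulmx1 mul1mx. Qed.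

(** Directions of the padded group have trivial exponentials in the second factor, so only the first
    component affects the function, and the zero second component pairs to nothing. *)
Lemma is_grad2_trivial_factor X H :
  is_grad1 G (fun X => ln (kappaT1 A Ad X)) X H ->
  is_grad2 with_trivial_factor (fun g => ln (kappaT2 A Ad g)) (X, 1%:M) (H, 0).
Proof.
move=> [[LH hH] dH]; split.
  split; first by move=> t; split; [exact: LH|exact: expm_scale0].
  by split=> //; apply/matrixP => i j; rewrite adjE !mxE conjc0.
move=> [H1 H2] [LH12 [/= hH1 hH2]].
have eF : (fun t : R => ln (kappaT2 A Ad (expm (t%:C *: H1) *m X, expm (t%:C *: H2) *m 1%:M))) =
    (fun t : R => ln (kappaT1 A Ad (expm (t%:C *: H1) *m X))).
  apply/funext => t; have [_ /= ->] := LH12 t.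
  by rewrite mulmx1 kappaT2_trivial_factor.
rewrite eF.
have -> : inner2 (H, 0) (H1, H2) = cinner H H1.
  have a0 : adj (0 : 'M[C]_n) = 0 by apply/matrixP => i j; rewrite adjE !mxE conjc0.
  by rewrite /inner2 /cinner /= a0 mul0mx mxtrace0 addr0.
apply: dH; split; last exact: hH1.
by move=> t; case: (LH12 t).
Qed.

Lemma inf_kappaT_trivial_factor :
  [set kappaT2 A Ad g | g in with_trivial_factor] = [set kappaT1 A Ad X | X in G].
Proof.
apply/seteqP; split=> [_ [[X Y] [/= GX ->] <-]|_ [X GX <-]].
  by exists X => //; rewrite kappaT2_trivial_factor.
by exists (X, 1%:M) => //; exact: kappaT2_trivial_factor.
Qed.

End SingleGroup.

(** * Convergence for both kinds of action *)

Lemma full_rank_neq0 (F : fieldType) m n (A : 'M[F]_(m, n)) :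
  (0 < m)%N -> (0 < n)%N -> \rank A = minn m n -> A != 0.
Proof.
move=> m0 n0 rk; have rpos : (0 < \rank A)%N by rewrite rk leq_min m0.
by apply: contraTneq rpos => ->; rewrite mxrank0.
Qed.

Local Open Scope classical_set_scope.
Local Open Scope complex_scope.
Unset Implicit Arguments.

Theorem mainTheorem4 :
  forall R : realType, exists c : R, 0 < c /\
  (* case (i): G <= GL_m x GL_n acting by (X, Y) . A = X A Y^-1 *)
  (forall (m n : nat) (G : set ('M[R[i]]_m * 'M[R[i]]_n))
      (A : 'M[R[i]]_(m, n)) (Ad : 'M[R[i]]_(n, m))
      (Xs : nat -> 'M[R[i]]_m) (Ys : nat -> 'M[R[i]]_n)
      (Hs : nat -> 'M[R[i]]_m * 'M[R[i]]_n),
    (0 < m)%N -> (0 < n)%N ->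
    symmetric2 G -> torus_in2 G ->
    \rank A = minn m n -> is_pinv A Ad ->
    Xs 0%N = 1%:M -> Ys 0%N = 1%:M ->
    (forall k, is_grad2 G (fun g => ln (kappaT2 A Ad g)) (Xs k, Ys k) (Hs k)) ->
    (forall k, Xs k.+1 = expm ((- 8^-1 : R)%:C *: (Hs k).1) *m Xs k /\
               Ys k.+1 = expm ((- 8^-1 : R)%:C *: (Hs k).2) *m Ys k) ->
    forall (eps : R) (T : nat), 0 < eps < 2^-1 ->
      c * (maxn (m ^ 3) (n ^ 3))%:R
        * ln (kappaF A Ad / inf [set kappaT2 A Ad g | g in G]) / eps ^+ 2 <= T%:R ->
      ln (kappaT2 A Ad (Xs T, Ys T)) - ln (inf [set kappaT2 A Ad g | g in G]) < eps)
  /\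
  (* case (ii): G <= GL_m acting by X . A = X A *)
  (forall (m n : nat) (G : set 'M[R[i]]_m)
      (A : 'M[R[i]]_(m, n)) (Ad : 'M[R[i]]_(n, m))
      (Xs : nat -> 'M[R[i]]_m) (Hs : nat -> 'M[R[i]]_m),
    (0 < m)%N -> (0 < n)%N ->
    symmetric1 G -> torus_in1 G ->
    \rank A = minn m n -> is_pinv A Ad ->
    Xs 0%N = 1%:M ->
    (forall k, is_grad1 G (fun X => ln (kappaT1 A Ad X)) (Xs k) (Hs k)) ->
    (forall k, Xs k.+1 = expm ((- 8^-1 : R)%:C *: Hs k) *m Xs k) ->
    forall (eps : R) (T : nat), 0 < eps < 2^-1 ->
      c * (maxn (m ^ 3) (n ^ 3))%:R
        * ln (kappaF A Ad / inf [set kappaT1 A Ad X | X in G]) / eps ^+ 2 <= T%:R ->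
      ln (kappaT1 A Ad (Xs T)) - ln (inf [set kappaT1 A Ad X | X in G]) < eps).
Proof.
move=> R; exists 256; split=> //; split.
  move=> m n G A Ad Xs Ys Hs m0 n0 symG torG rk pinv X0 Y0 grad step eps T heps hT.
  apply: (@gradient_descent_convergence R m n G A Ad (fun k => (Xs k, Ys k)) Hs) => //.
  - by left.
  - exact: full_rank_neq0 rk.
  - by rewrite X0 Y0.
  - by move=> k /=; have [-> ->] := step k.
move=> m n G A Ad Xs Hs m0 n0 symG torG rk pinv X0 grad step eps T heps.
rewrite -(inf_kappaT_trivial_factor (n := n) G A Ad) => hT.
rewrite -kappaT2_trivial_factor.
apply: (@gradient_descent_convergence R m n (with_trivial_factor G) A Ad
  (fun k => (Xs k, 1%:M)) (fun k => (Hs k, 0))) => //.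
- exact: symmetric2_with_trivial_factor.
- exact: torus_with_trivial_factor.
- exact: full_rank_neq0 rk.
- by rewrite X0.
- by move=> k; apply: is_grad2_trivial_factor.
- by move=> k /=; rewrite step expm_scale0 mulmx1.
Qed.
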